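(* Let $F(x,y) \in \mathbb{C}[x,y]$ be a polynomial of total degree $d \ge 1$ and let $G(x,y) \in \mathbb{C}[x,y]$ be a polynomial with exactly $t \ge 1$ monomials (i.e., $t$ nonzero coefficients). Suppose $p = (a,b) \in (\mathbb{C}\setminus\{0\})^2$ is an isolated solution of the system $F(x,y) = G(x,y) = 0$, i.e., $F(a,b)=G(a,b)=0$ and $I_p(F,G) < +\infty$. Then \[ I_p(F,G) \le \tfrac{5}{2} d^2 t^2 . \]
   Context: For $p=(a,b)\in\mathbb{C}^2$, let $O_p \subset \mathbb{C}(x,y)$ be the local ring of rational functions $F/G$ with $F,G\in\mathbb{C}[x,y]$ and $G(a,b)\neq 0$. The intersection multiplicity of $F,G\in\mathbb{C}[x,y]$ at $p$ is $I_p(F,G) := \dim_{\mathbb{C}} \bigl(O_p/\langle F,G\rangle\bigr)$, where $\langle F,G\rangle$ is the ideal of $O_p$ generated by $F$ and $G$ (possibly $+\infty$). *)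

(* Defs.v *)
(* Bivariate polynomials are {poly {poly R}}: P = sum_j P_j(x) y^j. *)
From HB Require Import structures.
From mathcomp Require Import all_boot all_order all_algebra.
From mathcomp Require Import fraction.
Set Implicit Arguments. Unset Strict Implicit. Unset Printing Implicit Defensive.
Import Order.TTheory GRing.Theory Num.Theory.
Local Open Scope ring_scope.

Section Bivariate.
Variable R : fieldType.

Notation bpoly := {poly {poly R}}.

Definition eval2 (P : bpoly) (a b : R) : R := (P.[b%:P]).[a].

(* total degree: max over nonzero monomials x^i y^j of i + j (0 for P = 0) *)
Definition tdeg (P : bpoly) : nat :=
  \max_(j < size P | (P`_j)%R != 0) ((size (P`_j)%R).-1 + j)%N.

Definition nmonomials (P : bpoly) : nat :=
  \sum_(j < size P) count (fun c : R => c != 0%R) (polyseq (P`_j)%R).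

Definition ffield := {fraction bpoly}.
Definition tofracb (P : bpoly) : ffield := FracField.tofrac P.

Definition in_local_ring (a b : R) (q : ffield) : Prop :=
  exists (f g : bpoly), eval2 g a b != 0 /\ q = tofracb f / tofracb g.

Definition in_local_ideal (F G : bpoly) (a b : R) (q : ffield) : Prop :=
  exists alpha beta : ffield, in_local_ring a b alpha /\ in_local_ring a b beta /\
    q = alpha * tofracb F + beta * tofracb G.

(* dim_R (O_p / <F,G>) >= n : there are n elements of O_p whose classes modulo
   <F,G> are R-linearly independent *)
Definition local_dim_ge (F G : bpoly) (a b : R) (n : nat) : Prop :=
  exists q : 'I_n -> ffield, (forall i, in_local_ring a b (q i)) /\
    forall c : 'I_n -> R,
      in_local_ideal F G a b (\sum_(i < n) tofracb ((c i)%:P%:P) * q i) ->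
      forall i, c i = 0.

Definition imult_finite (F G : bpoly) (a b : R) : Prop :=
  exists N : nat, forall n, local_dim_ge F G a b n -> (n <= N)%N.

(* I_p(F,G) <= num / den  (rational bound num/den, den > 0) *)
Definition imult_le (F G : bpoly) (a b : R) (num den : nat) : Prop :=
  forall n : nat, local_dim_ge F G a b n -> (n * den <= num)%N.
End Bivariate.

(* Main.v *)
(** Let A be the local ring of the curve F = 0 at p and E the derivation
    P |-> L * (x F_x * y P_y - y F_y * x P_x), where L is x - a or y - b.  In A,
    the maximal ideal multiplies the Jacobian of F and G into (G), so E maps
    the ideal (G) to itself.  If G is a combination of monomials m_1, ..., m_t,
    the Wronskian W = det (E^j m_k) therefore lies in the ideal (F, G).  Since
    E multiplies a monomial by a polynomial, W is a unit at p times a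
    polynomial of bidegree at most t(t-1)/2 * (d1 + 1, d2 + 1), where (d1, d2)
    is the bidegree of F, and a Bezout count for F and W bounds the
    multiplicity by t(t-1)/2 * (2 d1 d2 + d1 + d2) as soon as F is prime and
    does not divide W.  If F divides W, the monomials are linearly dependent
    modulo F and one of them can be eliminated from G.  For reducible F the
    multiplicity is subadditive and the bound superadditive. *)

Require Import Defs.
From HB Require Import structures.
From mathcomp Require Import all_boot all_order all_algebra.
From mathcomp Require Import fraction polyXY.
From mathcomp Require Import ring zify.
From Stdlib Require Import Classical.
Import Order.TTheory GRing.Theory Num.Theory.
Set Implicit Arguments. Unset Strict Implicit. Unset Printing Implicit Defensive.
Local Open Scope ring_scope.

(** The degree of [G] is not controlled, so Bezout is applied to [F] and a polynomial whose degree
    depends only on [F] and [t]. The fields [x d/dx] and [y d/dy] have every monomial as an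
    eigenvector, so the exponents of [G] enter only as scalar coefficients. The Jacobian itself need
    not lie in the ideal (at a transverse intersection it is a unit); this is why [E] carries the
    factor [L], at the cost of one degree per differentiation. Two choices of [L] occur because [E]
    must not vanish modulo [F]: [x - a] serves the primes of positive degree in [y], and [y - b]
    serves the line [x = a]. Primality matters because the Wronskian criterion needs a domain in
    which the quotients with zero derivative are constants of the base field. The expression 2 d1 d2
    + d1 + d2 is d1 (d2 + 1) + d2 (d1 + 1); for d1, d2 <= d it is at most 4 d^2, so the argument
    yields 2 d^2 t (t - 1), which lies below the stated bound. *)

Notation bpoly C := {poly {poly C}}.

(** * Evaluation at the point and membership in the local ideal *)

Lemma eval2D (C : fieldType) (a b : C) (P Q : bpoly C) :
  eval2 (P + Q) a b = eval2 P a b + eval2 Q a b.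
Proof. by rewrite /eval2 !hornerD. Qed.

Lemma eval2M (C : fieldType) (a b : C) (P Q : bpoly C) :
  eval2 (P * Q) a b = eval2 P a b * eval2 Q a b.
Proof. by rewrite /eval2 !hornerM. Qed.

Lemma eval2X (C : fieldType) (a b : C) (P : bpoly C) n :
  eval2 (P ^+ n) a b = eval2 P a b ^+ n.
Proof. by rewrite /eval2 !horner_exp. Qed.

Lemma eval2C (C : fieldType) (a b : C) (f : {poly C}) :
  eval2 f%:P a b = f.[a].
Proof. by rewrite /eval2 hornerC. Qed.

Lemma eval2_1 (C : fieldType) (a b : C) : eval2 (1 : bpoly C) a b = 1.
Proof. by rewrite /eval2 !hornerE. Qed.

(** Membership in the ideal of the local ring with denominators cleared: [U] is a unit there.
    [local_ideal_tofrac] makes the link with fractions. *)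
Definition loc_ideal (C : fieldType) (a b : C) (F G P : bpoly C) : Prop :=
  exists U A B, eval2 U a b != 0 /\ U * P = A * F + B * G.

Lemma loc_idealD (C : fieldType) (a b : C) (F G P Q : bpoly C) :
  loc_ideal a b F G P -> loc_ideal a b F G Q -> loc_ideal a b F G (P + Q).
Proof.
move=> [U [A [B [U0 e]]]] [V [A' [B' [V0 e']]]].
exists (U * V), (V * A + U * A'), (V * B + U * B'); split.
  by rewrite eval2M mulf_neq0.
have -> : U * V * (P + Q) = V * (U * P) + U * (V * Q) by ring.
rewrite e e'; ring.
Qed.

Lemma loc_idealMl (C : fieldType) (a b : C) (F G P Q : bpoly C) :
  loc_ideal a b F G P -> loc_ideal a b F G (Q * P).
Proof.
move=> [U [A [B [U0 e]]]]; exists U, (Q * A), (Q * B); split=> //.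
by rewrite mulrCA e; ring.
Qed.

Lemma loc_idealN (C : fieldType) (a b : C) (F G P : bpoly C) :
  loc_ideal a b F G P -> loc_ideal a b F G (- P).
Proof. by move=> h; rewrite -mulN1r; apply: loc_idealMl. Qed.

Lemma loc_idealB (C : fieldType) (a b : C) (F G P Q : bpoly C) :
  loc_ideal a b F G P -> loc_ideal a b F G Q -> loc_ideal a b F G (P - Q).
Proof. by move=> hP hQ; apply: loc_idealD => //; apply: loc_idealN. Qed.

Lemma loc_ideal_l (C : fieldType) (a b : C) (F G : bpoly C) :
  loc_ideal a b F G F.
Proof. by exists 1, 1, 0; rewrite eval2_1 oner_neq0; split=> //; ring. Qed.

Lemma loc_ideal_r (C : fieldType) (a b : C) (F G : bpoly C) :
  loc_ideal a b F G G.
Proof. by exists 1, 0, 1; rewrite eval2_1 oner_neq0; split=> //; ring. Qed.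

Lemma loc_ideal0 (C : fieldType) (a b : C) (F G : bpoly C) :
  loc_ideal a b F G 0.
Proof. by rewrite -(mul0r F); apply/loc_idealMl/loc_ideal_l. Qed.

Lemma loc_ideal_sum (C : fieldType) (a b : C) (F G : bpoly C) (I : finType)
    (P : I -> bpoly C) :
  (forall i, loc_ideal a b F G (P i)) -> loc_ideal a b F G (\sum_i P i).
Proof.
move=> h; elim/big_ind: _ => //; first exact: loc_ideal0.
by move=> P1 P2; apply: loc_idealD.
Qed.

Lemma loc_ideal_unit (C : fieldType) (a b : C) (F G V P : bpoly C) :
  eval2 V a b != 0 -> loc_ideal a b F G (V * P) -> loc_ideal a b F G P.
Proof.
move=> V0 [U [A [B [U0 e]]]]; exists (U * V), A, B.
by rewrite eval2M mulf_neq0 // -mulrA.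
Qed.

Lemma loc_ideal_sub (C : fieldType) (a b : C) (F G F' G' P : bpoly C) :
  loc_ideal a b F' G' F -> loc_ideal a b F' G' G ->
  loc_ideal a b F G P -> loc_ideal a b F' G' P.
Proof.
move=> hF hG [U [A [B [U0 e]]]]; apply: (loc_ideal_unit U0).
by rewrite e; apply: loc_idealD; apply: loc_idealMl.
Qed.

Lemma loc_idealC (C : fieldType) (a b : C) (F G P : bpoly C) :
  loc_ideal a b F G P -> loc_ideal a b G F P.
Proof. exact: loc_ideal_sub (loc_ideal_r _ _ _ _) (loc_ideal_l _ _ _ _). Qed.

Lemma loc_ideal_scale (C : fieldType) (a b : C) (F G V P : bpoly C) :
  loc_ideal a b F G P -> loc_ideal a b (V * F) (V * G) (V * P).
Proof.
move=> [U [A [B [U0 e]]]]; exists U, A, B; split=> //.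
by rewrite mulrCA e; ring.
Qed.

(** * Derivations, logarithmic vector fields and the Jacobian *)

Definition derivation (R : comNzRingType) (E : R -> R) : Prop :=
  (forall P Q, E (P + Q) = E P + E Q) /\
  (forall P Q, E (P * Q) = E P * Q + P * E Q).

Lemma derivation0 (R : comNzRingType) (E : R -> R) : derivation E -> E 0 = 0.
Proof. by case=> hD _; apply: (addrI (E 0)); rewrite -hD !addr0. Qed.

Lemma derivation1 (R : comNzRingType) (E : R -> R) : derivation E -> E 1 = 0.
Proof.
case=> _ hM; apply: (addrI (E 1)).
by rewrite addr0 -{3}(mulr1 1) hM mulr1 mul1r.
Qed.

Lemma derivationN (R : comNzRingType) (E : R -> R) P :
  derivation E -> E (- P) = - E P.
Proof.
move=> hE; apply: (addrI (E P)).
by rewrite -(proj1 hE) !subrr (derivation0 hE).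
Qed.

Lemma derivationB (R : comNzRingType) (E : R -> R) P Q :
  derivation E -> E (P - Q) = E P - E Q.
Proof. by move=> hE; rewrite (proj1 hE) derivationN. Qed.

Lemma derivation_sum (R : comNzRingType) (E : R -> R) (I : finType)
    (P : I -> R) :
  derivation E -> E (\sum_i P i) = \sum_i E (P i).
Proof.
move=> hE; elim/big_rec2: _ => [|i x y _ <-]; first exact: derivation0.
by rewrite (proj1 hE).
Qed.

Lemma derivationX (R : comNzRingType) (E : R -> R) P n :
  derivation E -> E (P ^+ n) = E P * P ^+ n.-1 *+ n.
Proof.
move=> hE; elim: n => [|[|n] IH]; first by rewrite expr0 derivation1.
  by rewrite expr1 expr0 mulr1.
rewrite exprS (proj2 hE) IH /= mulrnAr mulrCA -exprS.
by rewrite [in RHS]mulrS.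
Qed.

Lemma derivationZ (R : comNzRingType) (E1 E2 : R -> R) (A B : R) :
  derivation E1 -> derivation E2 -> derivation (fun P => A * E1 P + B * E2 P).
Proof.
move=> [hD1 hM1] [hD2 hM2]; split=> P Q; first by rewrite hD1 hD2; ring.
by rewrite hM1 hM2; ring.
Qed.

Lemma derivation_map (R : comNzRingType) (E : R -> R) :
  derivation E -> derivation (fun P : {poly R} => \poly_(i < size P) E P`_i).
Proof.
move=> hE.
have coefE (P : {poly R}) i : (\poly_(i < size P) E P`_i)`_i = E P`_i.
  rewrite coef_poly; case: ltnP => // h.
  by rewrite nth_default // derivation0.
split=> P Q; apply/polyP => i.
  by rewrite coefD !coefE coefD (proj1 hE).
rewrite coefD !coefM !coefE coefM derivation_sum // -big_split /=.
by apply: eq_bigr => j _; rewrite !coefE (proj2 hE).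
Qed.

Definition euler (R : comNzRingType) (p : {poly R}) : {poly R} := 'X * p^`().

Lemma euler_derivation (R : comNzRingType) : derivation (@euler R).
Proof.
by rewrite /euler; split=> P Q; rewrite ?derivD ?derivM; ring.
Qed.

Lemma coef_euler (R : comNzRingType) (p : {poly R}) i :
  (euler p)`_i = p`_i *+ i.
Proof. by rewrite /euler coefXM coef_deriv; case: i. Qed.

Definition eulerX (C : fieldType) (P : bpoly C) : bpoly C :=
  \poly_(i < size P) euler P`_i.

Definition eulerY (C : fieldType) (P : bpoly C) : bpoly C := euler P.

Lemma eulerX_derivation (C : fieldType) : derivation (@eulerX C).
Proof. exact: derivation_map (@euler_derivation _). Qed.

Lemma eulerY_derivation (C : fieldType) : derivation (@eulerY C).
Proof. exact: euler_derivation. Qed.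

Lemma coef_eulerX (C : fieldType) (P : bpoly C) j i :
  (eulerX P)`_j`_i = P`_j`_i *+ i.
Proof.
rewrite /eulerX coef_poly; case: ltnP => h; first by rewrite coef_euler.
by rewrite [P`_j]nth_default // coef0 mul0rn.
Qed.

Lemma coef_eulerY (C : fieldType) (P : bpoly C) j i :
  (eulerY P)`_j`_i = P`_j`_i *+ j.
Proof. by rewrite /eulerY coef_euler coefMn. Qed.

Lemma eulerXC (C : fieldType) (f : {poly C}) : eulerX f%:P = (euler f)%:P.
Proof.
apply/polyP => j; apply/polyP => i; rewrite coef_eulerX !coefC.
by case: eqP => _; rewrite ?coef_euler // coef0 mul0rn.
Qed.

Lemma eulerYC (C : fieldType) (f : {poly C}) : eulerY f%:P = 0.
Proof. by rewrite /eulerY /euler derivC mulr0. Qed.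

(* The Jacobian determinant of (F, G) for the fields x d/dx and y d/dy. *)
Definition jac (C : fieldType) (F G : bpoly C) : bpoly C :=
  eulerX F * eulerY G - eulerY F * eulerX G.

Lemma jac_derivation (C : fieldType) (F : bpoly C) : derivation (jac F).
Proof.
have := derivationZ (eulerX F) (- eulerY F) (@eulerY_derivation C) (@eulerX_derivation C).
by rewrite /jac; case=> hD hM; split=> P Q; [move: (hD P Q)|move: (hM P Q)]; rewrite !mulNr.
Qed.

Lemma jacC (C : fieldType) (F G : bpoly C) : jac F G = - jac G F.
Proof. by rewrite /jac; ring. Qed.

Lemma jacFF (C : fieldType) (F : bpoly C) : jac F F = 0.
Proof. by rewrite /jac; ring. Qed.

(** * The Jacobian annihilates the maximal ideal *)

Definition lineX (C : fieldType) (a : C) : bpoly C := ('X - a%:P)%:P.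
Definition lineY (C : fieldType) (b : C) : bpoly C := 'X - b%:P%:P.

Lemma eval_lineY (C : fieldType) (b : C) : (lineY b).[b%:P] = 0.
Proof. by rewrite /lineY !hornerE subrr. Qed.

Lemma split_lineY (C : fieldType) (b : C) (P : bpoly C) :
  exists Q, P = P.[b%:P]%:P + lineY b * Q.
Proof.
have : root (P - P.[b%:P]%:P) b%:P by rewrite rootE !hornerE subrr.
case/factor_theorem => Q e; exists Q.
by rewrite /lineY mulrC -e addrC subrK.
Qed.

Lemma divides_lineY (C : fieldType) (b : C) (P : bpoly C) :
  P.[b%:P] = 0 -> exists Q, P = lineY b * Q.
Proof.
by case: (split_lineY b P) => Q e P0; exists Q; rewrite e P0 polyC0 add0r.
Qed.

Lemma split_vanishing (C : fieldType) (a : C) (f : {poly C}) :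
  f != 0 -> exists u r, u.[a] != 0 /\ f = ('X - a%:P) ^+ r * u.
Proof.
case: (multiplicity_XsubC f a) => r [u hu e] f0; exists u, r.
by move: hu; rewrite f0 /= rootE => hu; rewrite mulrC -e.
Qed.

Lemma eulerX_lineY (C : fieldType) (b : C) : eulerX (lineY b) = 0.
Proof.
apply/polyP => j; apply/polyP => i.
rewrite coef_eulerX coefB coefX coefC !coef0 coefB.
case: i => [|i]; first by rewrite mulr0n.
by case: j => [|[|j]] /=; rewrite ?coef1 ?coefC ?coef0 /= subr0 mul0rn.
Qed.

Lemma jac_lineY (C : fieldType) (b : C) (F : bpoly C) :
  jac F (lineY b) = 'X * eulerX F.
Proof.
rewrite /jac eulerX_lineY mulr0 subr0 /eulerY /euler /lineY derivB derivX derivC.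
by rewrite subr0 mulr1 mulrC.
Qed.

(** The logarithmic derivative of [(x - a)^r u] has at most a simple pole at [a]; the factors
    [x - a] and [u] clear its denominators. *)
Lemma euler_power_unit (C : fieldType) (a : C) (u : {poly C}) r :
  exists h, ('X - a%:P) * (u * euler (('X - a%:P) ^+ r * u)) =
     ('X - a%:P) ^+ r * u * h.
Proof.
set x := 'X - a%:P.
have dx : euler x = 'X by rewrite /euler /x derivB derivX derivC subr0 mulr1.
case: r => [|r].
  by exists (x * euler u); rewrite expr0 !mul1r; ring.
exists (u * 'X *+ r.+1 + x * euler u).
rewrite (proj2 (@euler_derivation _)) (derivationX _ _ (@euler_derivation _)) dx /=.
rewrite exprS; ring.
Qed.

(* The induction step of Fulton's algorithm: the multiplicity is shared
   between [H] and the line [y = b]. *)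
Lemma jac_socle_step (C : fieldType) (a b : C) (F H L : bpoly C) :
  F.[b%:P] != 0 -> L = lineX a \/ L = lineY b ->
  loc_ideal a b F H (L * jac F H) ->
  loc_ideal a b F (lineY b * H) (L * jac F (lineY b * H)).
Proof.
move=> F0 hL hH; set Y := lineY b.
(* Leibniz separates the two contributions: the first is the hypothesis scaled by [Y], the second is
   the case [H = 1] scaled by [H]. *)
have -> : L * jac F (Y * H) = Y * (L * jac F H) + H * (L * jac F Y).
  by rewrite (proj2 (jac_derivation F)); ring.
apply: loc_idealD.
  apply: loc_ideal_sub (loc_ideal_scale Y hH); last exact: loc_ideal_r.
  exact/loc_idealMl/loc_ideal_l.
suff h : loc_ideal a b F Y (L * jac F Y).
  apply: loc_ideal_sub (loc_ideal_scale H h).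
    exact/loc_idealMl/loc_ideal_l.
  by rewrite mulrC; apply: loc_ideal_r.
case: hL => ->; last by rewrite mulrC; apply/loc_idealMl/loc_ideal_r.
have [Q eF] := split_lineY b F.
have [u [r [u0 eu]]] := split_vanishing a F0.
(* Modulo [Y], [F] becomes its restriction [(x - a)^r u] to the line, so [euler_power_unit] applies
   once the unit [u] is multiplied in. *)
rewrite jac_lineY mulrCA; apply: loc_idealMl.
apply: (@loc_ideal_unit _ _ _ _ _ u%:P); first by rewrite eval2C.
have -> : eulerX F = (euler F.[b%:P])%:P + Y * eulerX Q.
  rewrite {1}eF (proj1 (@eulerX_derivation _)) (proj2 (@eulerX_derivation _)) eulerXC.
  by rewrite eulerX_lineY mul0r add0r.
have [h eh] := euler_power_unit a u r.
have -> : u%:P * (lineX a * ((euler F.[b%:P])%:P + Y * eulerX Q)) =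
  h%:P * F + (u%:P * lineX a * eulerX Q - h%:P * Q) * Y.
  rewrite [X in h%:P * X]eF.
  have -> : u%:P * (lineX a * ((euler F.[b%:P])%:P + Y * eulerX Q)) =
     (('X - a%:P) * (u * euler F.[b%:P]))%:P + u%:P * lineX a * eulerX Q * Y.
     by rewrite /lineX !polyCM; ring.
  rewrite eu eh -/Y /lineX; move: Y => Y; rewrite !polyCM; ring.
by apply: loc_idealD; apply: loc_idealMl; [exact: loc_ideal_l|exact: loc_ideal_r].
Qed.

Lemma lineY_neq0 (C : fieldType) (b : C) : lineY b != 0.
Proof. by rewrite /lineY polyXsubC_eq0. Qed.

(** [F] does not vanish on the line [y = b], so restricting the relation to that line forces the
    coefficient of [F] to be divisible by [lineY b], which then cancels. *)
Lemma loc_ideal_lineY_pow (C : fieldType) (a b : C) (F H : bpoly C) m :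
  F.[b%:P] != 0 -> loc_ideal a b F (lineY b * H) (lineY b ^+ m.+1) ->
  loc_ideal a b F H (lineY b ^+ m).
Proof.
move=> F0 [U [A [B [U0 e]]]].
have : A.[b%:P] = 0.
  apply/eqP; rewrite -(mulIr_eq0 _ (mulIf F0)) -hornerM.
  have -> : A * F = U * lineY b ^+ m.+1 - B * (lineY b * H) by rewrite e addrK.
  by rewrite exprS hornerD hornerN !hornerM !eval_lineY !(mul0r, mulr0) subrr.
case/divides_lineY => A' eA; exists U, A', B; split=> //.
apply: (mulfI (lineY_neq0 b)).
by rewrite mulrCA -exprS e eA; ring.
Qed.

(* The Jacobian determinant of a regular sequence generates the socle of the
   quotient; only the annihilation by the maximal ideal is needed. *)
Lemma jac_socle (C : fieldType) (a b : C) (F G L : bpoly C) k m :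
  L = lineX a \/ L = lineY b ->
  loc_ideal a b F G (lineX a ^+ k) -> loc_ideal a b F G (lineY b ^+ m) ->
  loc_ideal a b F G (L * jac F G).
Proof.
move=> hL; elim: m F G => [|m IH] F G hX hY.
  (* With exponent 0 the ideal contains 1. *)
  by rewrite -[L * _]mulr1; apply: loc_idealMl; rewrite -(expr0 (lineY b)).
(* If one generator vanishes on the line, splitting off [lineY b] lowers the exponent of [lineY b]
   and the induction hypothesis applies. *)
have base F1 G1 : F1.[b%:P] != 0 -> G1.[b%:P] = 0 ->
    loc_ideal a b F1 G1 (lineX a ^+ k) ->
    loc_ideal a b F1 G1 (lineY b ^+ m.+1) -> loc_ideal a b F1 G1 (L * jac F1 G1).
  move=> F0 /divides_lineY[H ->] h1 h2; apply: jac_socle_step => //.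
  apply: IH; last exact: loc_ideal_lineY_pow h2.
  apply: loc_ideal_sub h1; first exact: loc_ideal_l.
  exact/loc_idealMl/loc_ideal_r.
(* If neither vanishes on the line, one Euclidean step on the restrictions, with the unit [u] in
   place of a division, produces [G2] vanishing there. It changes neither the ideal nor, modulo the
   ideal and up to [u], the Jacobian. *)
have main F1 G1 s r (u w : {poly C}) : (r <= s)%N -> u.[a] != 0 -> w.[a] != 0 ->
    F1.[b%:P] = ('X - a%:P) ^+ r * u -> G1.[b%:P] = ('X - a%:P) ^+ s * w ->
    loc_ideal a b F1 G1 (lineX a ^+ k) ->
    loc_ideal a b F1 G1 (lineY b ^+ m.+1) -> loc_ideal a b F1 G1 (L * jac F1 G1).
  move=> rs u0 w0 eF eG h1 h2.
  pose v := ('X - a%:P) ^+ (s - r) * w.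
  pose G2 := u%:P * G1 - v%:P * F1.
  have hG2 : loc_ideal a b F1 G1 G2.
    by apply: loc_idealB; apply: loc_idealMl; [exact: loc_ideal_r|exact: loc_ideal_l].
  have hG1 : loc_ideal a b F1 G2 G1.
    apply: (@loc_ideal_unit _ _ _ _ _ u%:P); first by rewrite eval2C.
    have -> : u%:P * G1 = G2 + v%:P * F1 by rewrite /G2 subrK.
    by apply: loc_idealD; [exact: loc_ideal_r|apply/loc_idealMl/loc_ideal_l].
  have incl P : loc_ideal a b F1 G1 P -> loc_ideal a b F1 G2 P.
    exact: loc_ideal_sub (loc_ideal_l _ _ _ _) hG1.
  have F10 : F1.[b%:P] != 0.
    rewrite eF mulf_neq0 // ?expf_neq0 ?polyXsubC_eq0 //.
    by apply: contraNneq u0 => ->; rewrite horner0.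
  have G20 : G2.[b%:P] = 0.
    rewrite /G2 !hornerE eF eG /v -{1}(subnK rs) exprD; ring.
  have := base F1 G2 F10 G20 (incl _ h1) (incl _ h2).
  move=> /(loc_ideal_sub (loc_ideal_l _ _ _ _) hG2) h.
  apply: (@loc_ideal_unit _ _ _ _ _ u%:P); first by rewrite eval2C.
  have -> : u%:P * (L * jac F1 G1) =
    L * jac F1 G2 - (L * jac F1 u%:P) * G1 + L * jac F1 v%:P * F1.
    rewrite /G2 (derivationB _ _ (jac_derivation F1)) !(proj2 (jac_derivation F1)).
    rewrite jacFF; move: (jac F1 G1) (jac F1 u%:P) (jac F1 v%:P) => J1 J2 J3.
    by move: u%:P v%:P => U V; ring.
  apply: loc_idealD; last exact/loc_idealMl/loc_ideal_l.
  by apply: loc_idealB => //; apply/loc_idealMl/loc_ideal_r.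
have [F0|F0] := eqVneq F.[b%:P] 0; have [G0|G0] := eqVneq G.[b%:P] 0.
(* Both vanish on the whole line: restricting the relation for [lineX a ^+ k] to it makes [U] vanish
   at the point. *)
- case: hX => U [A [B [U0 e]]].
  have := congr1 (fun P : bpoly C => P.[b%:P]) e.
  rewrite /= hornerD !hornerM F0 G0 !mulr0 addr0 horner_exp => /eqP.
  rewrite mulf_eq0 expf_eq0 /lineX hornerC polyXsubC_eq0 andbF orbF => /eqP U1.
  by move: U0; rewrite /eval2 U1 horner0 eqxx.
- rewrite jacC mulrN; apply/loc_idealN/loc_idealC.
  by apply: base => //; apply: loc_idealC.
- exact: base.
have [u [r [u0 eF]]] := split_vanishing a F0.
have [w [s [w0 eG]]] := split_vanishing a G0.
case: (leqP r s) => [rs|/ltnW sr]; first exact: main rs u0 w0 eF eG _ _.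
rewrite jacC mulrN; apply/loc_idealN/loc_idealC.
by apply: main sr w0 u0 eG eF _ _; apply: loc_idealC.
Qed.

(** * Wronskians modulo a prime *)

Definition divides (R : comNzRingType) (F P : R) : Prop := exists Q, P = Q * F.

Definition prime_elt (R : comNzRingType) (F : R) : Prop :=
  ~ divides F 1 /\
  forall P Q, divides F (P * Q) -> divides F P \/ divides F Q.

Lemma dividesD (R : comNzRingType) (F P Q : R) :
  divides F P -> divides F Q -> divides F (P + Q).
Proof. by case=> A -> [B ->]; exists (A + B); rewrite mulrDl. Qed.

Lemma dividesMl (R : comNzRingType) (F P Q : R) :
  divides F P -> divides F (Q * P).
Proof. by case=> A ->; exists (Q * A); rewrite mulrA. Qed.

Lemma dividesN (R : comNzRingType) (F P : R) : divides F P -> divides F (- P).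
Proof. by case=> A ->; exists (- A); rewrite mulNr. Qed.

Lemma dividesB (R : comNzRingType) (F P Q : R) :
  divides F P -> divides F Q -> divides F (P - Q).
Proof. by move=> hP hQ; apply: dividesD => //; apply: dividesN. Qed.

Lemma divides0 (R : comNzRingType) (F : R) : divides F 0.
Proof. by exists 0; rewrite mul0r. Qed.

Lemma divides_refl (R : comNzRingType) (F : R) : divides F F.
Proof. by exists 1; rewrite mul1r. Qed.

Lemma divides_sum (R : comNzRingType) (F : R) (I : finType) (P : I -> R) :
  (forall i, divides F (P i)) -> divides F (\sum_i P i).
Proof.
move=> h; elim/big_ind: _ => //; first exact: divides0.
by move=> P1 P2; apply: dividesD.
Qed.

Lemma divides_derivation (R : comNzRingType) (E : R -> R) (F P : R) :
  derivation E -> divides F (E F) -> divides F P -> divides F (E P).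
Proof.
move=> hE hF [Q ->]; rewrite (proj2 hE).
by apply: dividesD; apply: dividesMl => //; apply: divides_refl.
Qed.

Lemma divides_loc (C : fieldType) (a b : C) (F G P : bpoly C) :
  divides F P -> loc_ideal a b F G P.
Proof. by case=> Q ->; apply/loc_idealMl/loc_ideal_l. Qed.

Definition wronskian_mx (R : comNzRingType) (E : R -> R) t (m : 'I_t -> R) :
  'M[R]_t := \matrix_(j, k) iter j E (m k).

(** In the fraction field of the quotient by a prime [F], this says that an element [A / B] with
    zero derivative is a scalar; the second hypothesis is the numerator of the quotient rule. *)
Definition const_lemma (C : fieldType) (E : bpoly C -> bpoly C) (F : bpoly C) :
  Prop := forall A B, ~ divides F B -> divides F (B * E A - A * E B) ->
    exists c, divides F (A - c%:P%:P * B).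

Lemma mulmx_cofactor_row (R : comNzRingType) n (M : 'M[R]_n) i j :
  \sum_k M j k * cofactor M i k = \det M *+ (j == i).
Proof.
have := congr1 (fun N : 'M_n => N j i) (mul_mx_adj M).
by rewrite !mxE => <-; apply: eq_bigr => k _; rewrite mxE.
Qed.

(** Cramer's rule modulo [F]: multiply the system by the adjugate. *)
Lemma divides_det_kernel (R : comNzRingType) (F : R) n (M : 'M[R]_n)
    (b : 'I_n -> R) :
  (forall j, divides F (\sum_k M j k * b k)) ->
  forall k, divides F (\det M * b k).
Proof.
move=> h k.
have -> : \det M * b k = \sum_j \adj M k j * \sum_l M j l * b l.
  transitivity (((\adj M *m M) *m \col_l b l) k 0).
    by rewrite mul_adj_mx mul_scalar_mx !mxE.
  rewrite -mulmxA !mxE; apply: eq_bigr => j _; congr (_ * _).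
  by rewrite !mxE; apply: eq_bigr => l _; rewrite !mxE.
by apply: divides_sum => j; apply: dividesMl.
Qed.

Lemma cofactor_max (R : comNzRingType) n (E : R -> R) (m : 'I_n.+1 -> R) :
  cofactor (wronskian_mx E m) ord_max ord_max =
  \det (wronskian_mx E (fun k => m (lift ord_max k))).
Proof.
rewrite /cofactor addnn -signr_odd odd_double expr0 mul1r.
by congr (\det _); apply/matrixP => j k; rewrite !mxE; congr (iter _ E _); apply: lift_max.
Qed.

Lemma big_ord_lift_max (R : nmodType) n (f : 'I_n.+1 -> R) :
  \sum_k f k = \sum_k f (lift ord_max k) + f ord_max.
Proof.
rewrite big_ord_recr /=; congr (_ + _); apply: eq_bigr => k _; congr f.
by apply: val_inj; apply: esym (lift_max k).
Qed.

(** The classical criterion over the domain of functions on [F = 0]. If the smaller Wronskian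
    survives modulo [F], the cofactors of the last row span the kernel over the fraction field, and
    their ratios turn out to be constants. *)
Lemma wronskian_dependent (C : fieldType) (E : bpoly C -> bpoly C) (F : bpoly C)
    t (m : 'I_t -> bpoly C) :
  derivation E -> divides F (E F) -> prime_elt F -> const_lemma E F ->
  divides F (\det (wronskian_mx E m)) ->
  exists c : 'I_t -> C, (exists k, c k != 0) /\
    divides F (\sum_k (c k)%:P%:P * m k).
Proof.
move=> hE hF [hF1 hp] hc; elim: t m => [|n IH] m hW.
  by case: hF1; rewrite det_mx00 in hW.
set M := wronskian_mx E m in hW *.
pose m' k := m (lift ord_max k).
case: (classic (divides F (\det (wronskian_mx E m')))) => [/IH|hW'].
  move=> [c [[k ck] hs]].
  exists (fun i => if unlift ord_max i is Some j then c j else 0); split.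
    by exists (lift ord_max k); rewrite liftK.
  rewrite big_ord_lift_max unlift_none !polyC0 mul0r addr0.
  by under eq_bigr => i _ do rewrite liftK.
pose s k := cofactor M ord_max k.
have es : s ord_max = \det (wronskian_mx E m') by rewrite /s cofactor_max.
(* Rows other than the last give an expansion along a wrong row, which is 0; the last row gives the
   determinant, divisible by hypothesis. *)
have rel (j : 'I_n.+1) : divides F (\sum_k iter j E (m k) * s k).
  have := mulmx_cofactor_row M ord_max j.
  under eq_bigr => k _ do rewrite mxE.
  by move=> ->; case: (j == _); [rewrite mulr1n|rewrite mulr0n; apply: divides0].
(* Differentiating relation [j] and subtracting relation [j + 1] leaves only the derivatives of the
   cofactors. *)
have relE (j : 'I_n) : divides F (\sum_k iter j E (m k) * E (s k)).
  have h1 := divides_derivation hE hF (rel (lift ord_max j)).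
  have h2 := rel (lift ord0 j).
  rewrite derivation_sum // in h1.
  have := dividesB h1 h2; rewrite -sumrB.
  rewrite (eq_bigr (fun k => iter j E (m k) * E (s k))) // => k _.
  by rewrite (proj2 hE) lift_max /= addrC addKr.
(* Numerator of the derivative of [s k / s ord_max]. These form a kernel vector of the smaller
   Wronskian, hence vanish modulo [F]. *)
pose r k := s ord_max * E (s k) - s k * E (s ord_max).
have relr (j : 'I_n) :
    divides F (\sum_k (wronskian_mx E m') j k * r (lift ord_max k)).
  have h := dividesB (dividesMl (s ord_max) (relE j))
              (dividesMl (E (s ord_max)) (rel (lift ord_max j))).
  rewrite !mulr_sumr -sumrB big_ord_lift_max in h.
  have e0 : s ord_max * (iter j E (m ord_max) * E (s ord_max)) -
     E (s ord_max) * (iter (lift ord_max j) E (m ord_max) * s ord_max) = 0.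
    by rewrite lift_max; ring.
  rewrite e0 addr0 in h; congr divides: h.
  by apply: eq_bigr => k _; rewrite mxE /r lift_max /m'; ring.
have hr k : divides F (r k).
  case: (unliftP ord_max k) => [k' ->|->]; last first.
    by rewrite /r subrr; apply: divides0.
  by case: (hp _ _ (divides_det_kernel relr k')).
have /fin_all_exists [c hcs] k : exists c, divides F (s k - c%:P%:P * s ord_max).
  by apply: hc; [rewrite es|exact: hr].
pose c' k := if k == ord_max then 1 else c k.
have hcs' k : divides F (s k - (c' k)%:P%:P * s ord_max).
  rewrite /c'; case: eqP => [->|//].
  by rewrite mul1r subrr; apply: divides0.
exists c'; split; first by exists ord_max; rewrite /c' eqxx oner_neq0.
have := rel ord0; rewrite /= => h.
have : divides F (s ord_max * \sum_k (c' k)%:P%:P * m k).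
  have h' : divides F (\sum_k m k * (s k - (c' k)%:P%:P * s ord_max)).
    by apply: divides_sum => k; apply: dividesMl.
  have := dividesB h h'; rewrite -sumrB => h''; congr divides: h''.
  by rewrite mulr_sumr; apply: eq_bigr => k _; ring.
by case/hp => //; rewrite es.
Qed.

(** * Bidegrees and Wronskians of monomials *)

Definition bideg_le (C : fieldType) (u v : nat) (P : bpoly C) : Prop :=
  forall j i, P`_j`_i != 0 -> (i <= u)%N && (j <= v)%N.

Lemma bideg_le0 (C : fieldType) u v : bideg_le u v (0 : bpoly C).
Proof. by move=> j i; rewrite !coef0 eqxx. Qed.

Lemma bideg_leD (C : fieldType) u v (P Q : bpoly C) :
  bideg_le u v P -> bideg_le u v Q -> bideg_le u v (P + Q).
Proof.
move=> hP hQ j i; rewrite !coefD.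
have [->|/hP //] := eqVneq P`_j`_i 0.
by rewrite add0r => /hQ.
Qed.

Lemma bideg_leN (C : fieldType) u v (P : bpoly C) :
  bideg_le u v P -> bideg_le u v (- P).
Proof. by move=> hP j i; rewrite !coefN oppr_eq0 => /hP. Qed.

Lemma bideg_le_sum (C : fieldType) (I : finType) u v (P : I -> bpoly C) :
  (forall i, bideg_le u v (P i)) -> bideg_le u v (\sum_i P i).
Proof.
move=> h; elim/big_ind: _ => //; first exact: bideg_le0.
by move=> P1 P2; apply: bideg_leD.
Qed.

Lemma bideg_leM (C : fieldType) u v u' v' (P Q : bpoly C) :
  bideg_le u v P -> bideg_le u' v' Q -> bideg_le (u + u') (v + v') (P * Q).
Proof.
move=> hP hQ j i h; apply/negPn/negP => hn; move/eqP: h; apply.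
rewrite coefM coef_sum big1 // => k _; rewrite coefM big1 // => l _.
apply/eqP; rewrite mulf_eq0; apply/orP.
have [_|/hP hp] := eqVneq P`_k`_l 0; first by left.
have [_|/hQ hq] := eqVneq Q`_(j - k)`_(i - l) 0; first by right.
have := ltn_ord k; have := ltn_ord l; move: hn hp hq; lia.
Qed.

Lemma bideg_leW (C : fieldType) u v u' v' (P : bpoly C) :
  (u <= u')%N -> (v <= v')%N -> bideg_le u v P -> bideg_le u' v' P.
Proof. by move=> hu hv hP j i /hP; lia. Qed.

Lemma bideg_le1 (C : fieldType) u v : bideg_le u v (1 : bpoly C).
Proof. by move=> [|j] [|i]; rewrite !coef1 ?coef0 ?eqxx. Qed.

Lemma bideg_leMn (C : fieldType) u v n (P : bpoly C) :
  bideg_le u v P -> bideg_le u v (P *+ n).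
Proof.
move=> hP j i; rewrite !coefMn; have [->|/hP //] := eqVneq P`_j`_i 0.
by rewrite mul0rn eqxx.
Qed.

Lemma bideg_le_eulerX (C : fieldType) u v (P : bpoly C) :
  bideg_le u v P -> bideg_le u v (eulerX P).
Proof.
move=> hP j i; rewrite coef_eulerX; have [->|/hP //] := eqVneq P`_j`_i 0.
by rewrite mul0rn eqxx.
Qed.

Lemma bideg_le_eulerY (C : fieldType) u v (P : bpoly C) :
  bideg_le u v P -> bideg_le u v (eulerY P).
Proof.
move=> hP j i; rewrite coef_eulerY; have [->|/hP //] := eqVneq P`_j`_i 0.
by rewrite mul0rn eqxx.
Qed.

Lemma bideg_le_jac (C : fieldType) u v u' v' (P Q : bpoly C) :
  bideg_le u v P -> bideg_le u' v' Q ->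
  bideg_le (u + u') (v + v') (jac P Q).
Proof.
move=> hP hQ; apply: bideg_leD; last apply: bideg_leN;
  by apply: bideg_leM; auto using bideg_le_eulerX, bideg_le_eulerY.
Qed.

(** The bound (1, 1) is deliberately coarse: it is shared with [lineY], so one degree count covers
    both choices of [L]. *)
Lemma bideg_le_lineX (C : fieldType) (a : C) : bideg_le 1 1 (lineX a).
Proof.
move=> [|j] i; rewrite coefC /= ?coef0 ?eqxx //.
by rewrite coefB coefX coefC; case: i => [|[|i]] //=; rewrite subr0 eqxx.
Qed.

Lemma bideg_le_lineY (C : fieldType) (b : C) : bideg_le 1 1 (lineY b).
Proof.
move=> j i; rewrite coefB coefX coefC.
case: j => [|[|j]] /=; rewrite ?subr0 ?sub0r ?coef0 ?eqxx //.
  by rewrite coefN coefC; case: i => //=; rewrite oppr0 eqxx.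
by rewrite coef1; case: i => //=; rewrite eqxx.
Qed.

Definition monom (C : fieldType) (i j : nat) : bpoly C := ('X^i)%:P * 'X^j.

Lemma jac_monom (C : fieldType) (F : bpoly C) i j :
  jac F (monom C i j) =
  monom C i j * (eulerX F *+ j - eulerY F *+ i).
Proof.
have eX : eulerX (monom C i j) = monom C i j *+ i.
  apply/polyP => k; apply/polyP => l; rewrite coef_eulerX !coefMn.
  rewrite /monom coefMXn; case: ifP => _; first by rewrite coef0 !mul0rn.
  rewrite coefC; case: eqP => _; last by rewrite coef0 !mul0rn.
  by rewrite coefXn; case: eqP => [->|_] //; rewrite !mul0rn.
have eY : eulerY (monom C i j) = monom C i j *+ j.
  apply/polyP => k; apply/polyP => l; rewrite coef_eulerY !coefMn.
  rewrite /monom coefMXn; case: ltnP => hk; first by rewrite coef0 !mul0rn.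
  rewrite coefC subn_eq0; case: leqP => hk'; last by rewrite coef0 !mul0rn.
  by have -> : k = j by apply/eqP; rewrite eqn_leq hk hk'.
by rewrite /jac eX eY; ring.
Qed.

Lemma jacL_derivation (C : fieldType) (L F : bpoly C) :
  derivation (fun P => L * jac F P).
Proof.
have := derivationZ L 0 (jac_derivation F) (jac_derivation F).
by case=> hD hM; split=> P Q; [move: (hD P Q)|move: (hM P Q)];
  rewrite !mul0r !addr0.
Qed.

(** Differentiate [U P = A F + B G]: [F] is killed, since [jac F F = 0], and [G] stays in the ideal
    by hypothesis. *)
Lemma jacL_stable (C : fieldType) (a b : C) (L F G P : bpoly C) :
  loc_ideal a b F G (L * jac F G) -> loc_ideal a b F G P ->
  loc_ideal a b F G (L * jac F P).
Proof.
set E := fun P => L * jac F P; move=> hG hP.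
have hE : derivation E := jacL_derivation L F.
case: (hP) => [U [A [B [U0 e]]]].
apply: (loc_ideal_unit U0).
have EF : E F = 0 by rewrite /E jacFF mulr0.
have := congr1 E e; rewrite (proj1 hE) !(proj2 hE) EF mulr0 addr0.
move=> e'; have -> : U * E P = E A * F + (E B * G + B * E G) - E U * P.
  by rewrite -e'; ring.
apply: loc_idealB; last exact: loc_idealMl.
apply: loc_idealD; first exact/loc_idealMl/loc_ideal_l.
by apply: loc_idealD; apply: loc_idealMl => //; apply: loc_ideal_r.
Qed.

(** The vector of coefficients is sent by the Wronskian matrix to the iterates [E^j G], all in the
    ideal. The adjugate then puts [c k0] times the determinant in the ideal, and [c k0] is a
    unit. *)
Lemma wronskian_loc (C : fieldType) (a b : C) (L F G : bpoly C) t
    (m : 'I_t -> bpoly C) (c : 'I_t -> C) k0 :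
  loc_ideal a b F G (L * jac F G) ->
  G = \sum_k (c k)%:P%:P * m k -> c k0 != 0 ->
  loc_ideal a b F G (\det (wronskian_mx (fun P => L * jac F P) m)).
Proof.
set E := fun P => L * jac F P; move=> hG eG c0.
have hE : derivation E := jacL_derivation L F.
have EC x : E x%:P%:P = 0.
  by rewrite /E /jac eulerXC eulerYC /euler derivC !(mulr0, polyC0, subrr).
have iterE n : iter n E G = \sum_k iter n E (m k) * (c k)%:P%:P.
  elim: n => [|n IH] /=; first by rewrite eG; apply: eq_bigr => k _; ring.
  rewrite IH derivation_sum //; apply: eq_bigr => k _.
  by rewrite (proj2 hE) EC mulr0 addr0.
have hn n : loc_ideal a b F G (iter n E G).
  elim: n => [|n IH] /=; first exact: loc_ideal_r.
  exact: jacL_stable.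
set M := wronskian_mx E m.
apply: (@loc_ideal_unit _ _ _ _ _ (c k0)%:P%:P).
  by rewrite eval2C hornerC.
have -> : (c k0)%:P%:P * \det M = \sum_j \adj M k0 j * iter j E G.
  transitivity (((\adj M *m M) *m \col_l (c l)%:P%:P) k0 0).
    by rewrite mul_adj_mx mul_scalar_mx !mxE mulrC.
  rewrite -mulmxA !mxE; apply: eq_bigr => j _; rewrite iterE; congr (_ * _).
  by rewrite !mxE; apply: eq_bigr => l _; rewrite !mxE.
by apply: loc_ideal_sum => j; apply: loc_idealMl.
Qed.

(** The cofactor of the monomial in its [n]-th derivative. The exponents [i], [j] occur only as
    integer multiples, so its degree does not depend on them. *)
Fixpoint wronskian_coef (C : fieldType) (L F : bpoly C) (i j n : nat) : bpoly C :=
  if n is n'.+1 then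
    L * (jac F (wronskian_coef L F i j n') +
         (eulerX F *+ j - eulerY F *+ i) * wronskian_coef L F i j n')
  else 1.

Lemma iter_jacL_monom (C : fieldType) (L F : bpoly C) i j n :
  iter n (fun P => L * jac F P) (monom C i j) =
  monom C i j * wronskian_coef L F i j n.
Proof.
elim: n => [|n IH] /=; first by rewrite mulr1.
rewrite IH (proj2 (jac_derivation F)) jac_monom.
by move: (monom C i j) (wronskian_coef _ _ _ _ _) (jac F _) => m w J; ring.
Qed.

Lemma bideg_wronskian_coef (C : fieldType) (L F : bpoly C) d1 d2 i j n :
  bideg_le 1 1 L -> bideg_le d1 d2 F ->
  bideg_le (n * d1.+1) (n * d2.+1) (wronskian_coef L F i j n).
Proof.
move=> hL hF; elim: n => [|n IH] /=; first exact: bideg_le1.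
have -> k d : (k.+1 * d.+1 = 1 + (d + k * d.+1))%N by lia.
have -> k d : (k.+1 * d.+1 = 1 + (d + k * d.+1))%N by lia.
apply: bideg_leM => //; apply: bideg_leD; first exact: bideg_le_jac.
apply: bideg_leM => //; apply: bideg_leD; last apply: bideg_leN;
  by apply: bideg_leMn; auto using bideg_le_eulerX, bideg_le_eulerY.
Qed.

Definition reduced_wronskian (C : fieldType) (L F : bpoly C) t
  (e : 'I_t -> nat * nat) : bpoly C :=
  \det (\matrix_(j < t, k < t) wronskian_coef L F (e k).1 (e k).2 j).

Lemma wronskian_monom (C : fieldType) (L F : bpoly C) t (e : 'I_t -> nat * nat) :
  \det (wronskian_mx (fun P => L * jac F P) (fun k => monom C (e k).1 (e k).2)) =
  (\prod_k monom C (e k).1 (e k).2) * reduced_wronskian L F e.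
Proof.
rewrite /reduced_wronskian mulrC.
have -> : \prod_k monom C (e k).1 (e k).2 =
  \det (diag_mx (\row_k monom C (e k).1 (e k).2)).
  by rewrite det_diag; apply: eq_bigr => k _; rewrite mxE.
rewrite -det_mulmx; congr (\det _); apply/matrixP => j k.
by rewrite mul_mx_diag !mxE iter_jacL_monom mulrC.
Qed.

Lemma bideg_le_prod (C : fieldType) (I : finType) (u v : I -> nat)
    (P : I -> bpoly C) :
  (forall i, bideg_le (u i) (v i) (P i)) ->
  bideg_le (\sum_i u i) (\sum_i v i) (\prod_i P i).
Proof.
move=> h; elim/big_rec3: _ => [|i x y z _ IH]; first exact: bideg_le1.
exact: bideg_leM.
Qed.

(** Row [j] contributes [j] times [(d1 + 1, d2 + 1)] to every term of the determinant, and the row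
    indices sum to ['C(t, 2)]. *)
Lemma bideg_reduced_wronskian (C : fieldType) (L F : bpoly C) d1 d2 t
    (e : 'I_t -> nat * nat) :
  bideg_le 1 1 L -> bideg_le d1 d2 F ->
  bideg_le ('C(t, 2) * d1.+1) ('C(t, 2) * d2.+1) (reduced_wronskian L F e).
Proof.
move=> hL hF; apply: bideg_le_sum => s.
rewrite mulr_sign; case: perm.odd_perm; first apply: bideg_leN.
all: rewrite -bin2_sum big_mkord !big_distrl; apply: bideg_le_prod => j.
all: by rewrite mxE; apply: bideg_wronskian_coef.
Qed.

(** * Dimension bounds *)

Lemma dim_le_of_kernel (C : fieldType) (U V W : vectType C)
    (f : U -> V) (g : W -> U) :
  linear f -> linear g -> (forall u, f u = 0 -> exists w, u = g w) ->
  (dim U <= dim V + dim W)%N.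
Proof.
move=> hf hg hk.
pose f' : {linear U -> V} := HB.pack f (GRing.isLinear.Build _ _ _ _ f hf).
pose g' : {linear W -> U} := HB.pack g (GRing.isLinear.Build _ _ _ _ g hg).
have := limg_ker_dim (linfun f') fullv; rewrite capfv dimvf => <-.
rewrite addnC; apply: leq_add; first by rewrite -dimvf dimvS ?subvf.
have hsub : (lker (linfun f') <= limg (linfun g'))%VS.
  apply/subvP => u; rewrite memv_ker lfunE => /eqP /hk [w ->].
  by apply/memv_imgP; exists w; rewrite ?memvf // lfunE.
apply: leq_trans (dimvS hsub) _.
by have := limg_ker_dim (linfun g') fullv; rewrite dimvf; lia.
Qed.

Definition degX (C : fieldType) (P : bpoly C) : nat := (sizeY P).-1.
Definition degY (C : fieldType) (P : bpoly C) : nat := (size P).-1.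

Lemma bideg_leP (C : fieldType) u v (P : bpoly C) :
  bideg_le u v P <-> (sizeY P <= u.+1)%N /\ (size P <= v.+1)%N.
Proof.
split=> [h|[hu hv] j i h].
  split; last first.
    apply/leq_sizeP => j hj; apply/polyP => i; rewrite coef0; apply/eqP/negPn.
    by apply/negP => /h; lia.
  rewrite sizeYE; apply/leq_sizeP => i hi; apply/polyP => j.
  rewrite coef_swapXY coef0; apply/eqP/negPn.
  by apply/negP => /h; lia.
apply/andP; split; rewrite leqNgt; apply/negP => hh; case/eqP: h.
  rewrite -coef_swapXY [(swapXY P)`_i]nth_default ?coef0 // -sizeYE.
  exact: leq_trans hu hh.
by rewrite [P`_j]nth_default ?coef0 //; apply: leq_trans hv hh.
Qed.

Lemma bideg_exact (C : fieldType) (P : bpoly C) :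
  bideg_le (degX P) (degY P) P.
Proof. by apply/bideg_leP; rewrite /degX /degY !leqSpred. Qed.

Lemma degYM (C : fieldType) (P Q : bpoly C) :
  P != 0 -> Q != 0 -> degY (P * Q) = (degY P + degY Q)%N.
Proof.
move=> P0 Q0; rewrite /degY size_mul //; move: P0 Q0; rewrite -!size_poly_gt0.
by case: (size P) => // p _; case: (size Q) => // q _; rewrite addnS.
Qed.

Lemma degXM (C : fieldType) (P Q : bpoly C) :
  P != 0 -> Q != 0 -> degX (P * Q) = (degX P + degX Q)%N.
Proof.
move=> P0 Q0; rewrite /degX !sizeYE rmorphM.
by apply: degYM; rewrite swapXY_eq0.
Qed.

Lemma bideg_le_quotient (C : fieldType) u v (Q F : bpoly C) :
  F != 0 -> bideg_le (u + degX F) (v + degY F) (Q * F) -> bideg_le u v Q.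
Proof.
move=> F0; have [->|Q0] := eqVneq Q 0; first by move=> _; apply: bideg_le0.
move=> /bideg_leP [hu hv]; apply/bideg_leP.
have := degXM Q0 F0; have := degYM Q0 F0.
by move: hu hv; rewrite /degX /degY; lia.
Qed.

Definition bpoly_of_mx (C : fieldType) u v (A : 'M[C]_(v, u)) : bpoly C :=
  \sum_j \sum_i (A j i)%:P%:P * monom C i j.
Definition mx_of_bpoly (C : fieldType) u v (P : bpoly C) : 'M[C]_(v, u) :=
  \matrix_(j, i) P`_j`_i.

Lemma coef_monom (C : fieldType) (c : C) i j k l :
  (c%:P%:P * monom C i j)`_k`_l = c *+ ((k == j) && (l == i)).
Proof.
rewrite /monom mulrA -polyCM coefMXn.
case: ltnP => hk; first by rewrite coef0 (ltn_eqF hk).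
rewrite coefC subn_eq0.
have -> : (k == j) = (k <= j)%N by rewrite eqn_leq hk andbT.
case: leqP => _; last by rewrite coef0.
rewrite coefCM coefXn andTb.
by case: (l == i); rewrite ?mulr1 ?mulr0.
Qed.

Lemma coef_bpoly_of_mx (C : fieldType) u v (A : 'M[C]_(v, u)) k l :
  (bpoly_of_mx A)`_k`_l =
  \sum_j \sum_i A j i *+ ((k == j) && (l == i)).
Proof.
rewrite /bpoly_of_mx !coef_sum; apply: eq_bigr => j _.
by rewrite !coef_sum; apply: eq_bigr => i _; rewrite coef_monom.
Qed.

Lemma bideg_bpoly_of_mx (C : fieldType) u v (A : 'M[C]_(v.+1, u.+1)) :
  bideg_le u v (bpoly_of_mx A).
Proof.
move=> k l; rewrite coef_bpoly_of_mx => h; apply/negPn/negP => hn.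
case/eqP: h; rewrite big1 // => j _; rewrite big1 // => i _.
case: eqP => [ek|]; last by rewrite mulr0n.
case: eqP => [el|]; last by rewrite mulr0n.
by have := ltn_ord i; have := ltn_ord j; move: hn; lia.
Qed.

Lemma mx_of_bpolyK (C : fieldType) u v (P : bpoly C) :
  bideg_le u v P -> bpoly_of_mx (mx_of_bpoly u.+1 v.+1 P) = P.
Proof.
move=> hP; apply/polyP => k; apply/polyP => l; rewrite coef_bpoly_of_mx.
have [hk|hk] := leqP k v; last first.
  rewrite big1.
    by apply/esym/eqP/negPn/negP => /hP; lia.
  move=> j _; rewrite big1 // => i _; case: eqP => // e.
  by have := ltn_ord j; lia.
have [hl|hl] := leqP l u; last first.
  rewrite big1.
    by apply/esym/eqP/negPn/negP => /hP; lia.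
  move=> j _; rewrite big1 // => i _; case: (l =P i) => [e|]; last by rewrite andbF.
  by have := ltn_ord i; lia.
rewrite (bigD1 (Ordinal (hk : (k < v.+1)%N))) //= [X in _ + X]big1 => [|j hj].
  rewrite addr0 (bigD1 (Ordinal (hl : (l < u.+1)%N))) //= [X in _ + X]big1 => [|i hi].
    by rewrite !eqxx mulr1n addr0 /mx_of_bpoly mxE.
  have -> : (l == i) = false; last by rewrite andbF.
  by apply/negbTE; apply: contraNneq hi => e; apply/eqP/val_inj.
rewrite big1 // => i _; have -> // : (k == j) = false.
by apply/negbTE; apply: contraNneq hj => e; apply/eqP/val_inj.
Qed.

Lemma mx_of_bpoly_inj (C : fieldType) u v (P : bpoly C) :
  bideg_le u v P -> mx_of_bpoly u.+1 v.+1 P = 0 -> P = 0.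
Proof.
move=> hP h; rewrite -(mx_of_bpolyK hP) h /bpoly_of_mx big1 // => j _.
by rewrite big1 // => i _; rewrite mxE !polyC0 mul0r.
Qed.

Lemma mx_of_bpolyD (C : fieldType) u v (P Q : bpoly C) :
  mx_of_bpoly u v (P + Q) = mx_of_bpoly u v P + mx_of_bpoly u v Q.
Proof. by apply/matrixP => j i; rewrite /mx_of_bpoly !mxE !coefD. Qed.

Lemma mx_of_bpolyZ (C : fieldType) u v c (P : bpoly C) :
  mx_of_bpoly u v (c%:P%:P * P) = c *: mx_of_bpoly u v P.
Proof. by apply/matrixP => j i; rewrite /mx_of_bpoly !mxE !coefCM. Qed.

Lemma bpoly_of_mxP (C : fieldType) u v c (A B : 'M[C]_(v, u)) :
  bpoly_of_mx (c *: A + B) = c%:P%:P * bpoly_of_mx A + bpoly_of_mx B.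
Proof.
rewrite /bpoly_of_mx mulr_sumr -big_split; apply: eq_bigr => j _ /=.
rewrite mulr_sumr -big_split; apply: eq_bigr => i _ /=.
by rewrite !mxE !polyCD !polyCM; ring.
Qed.

Definition indep_mod (C : fieldType) (a b : C) (F G : bpoly C) n
    (h : 'I_n -> bpoly C) : Prop :=
  forall c : 'I_n -> C,
    loc_ideal a b F G (\sum_i (c i)%:P%:P * h i) -> forall i, c i = 0.

(** An upper bound on the dimension, dual to [indep_mod]: spanning families can be glued along a
    factorization of [F], while independent ones suit the definition of multiplicity and the Bezout
    count. *)
Definition spanned (C : fieldType) (a b : C) (F G : bpoly C) (N : nat) : Prop :=
  exists k (s : 'I_k -> bpoly C), (k <= N)%N /\
    forall P, exists c : 'I_k -> C,
      loc_ideal a b F G (P - \sum_i (c i)%:P%:P * s i).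

Lemma spannedW (C : fieldType) (a b : C) (F G : bpoly C) N N' :
  (N <= N')%N -> spanned a b F G N -> spanned a b F G N'.
Proof. by move=> h [k [s [hk hs]]]; exists k, s; split=> //; apply: leq_trans hk h. Qed.

Lemma spanned_sub (C : fieldType) (a b : C) (F G F' G' : bpoly C) N :
  loc_ideal a b F' G' F -> loc_ideal a b F' G' G ->
  spanned a b F G N -> spanned a b F' G' N.
Proof.
move=> hF hG [k [s [hk hs]]]; exists k, s; split=> // P.
by case: (hs P) => c hc; exists c; apply: loc_ideal_sub hc.
Qed.

Lemma spanned_unit (C : fieldType) (a b : C) (F G : bpoly C) :
  loc_ideal a b F G 1 -> spanned a b F G 0.
Proof.
move=> h; exists 0, (fun=> 0); split=> // P; exists (fun=> 0).
by rewrite -[X in loc_ideal _ _ _ _ X]mulr1; apply: loc_idealMl.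
Qed.

Lemma spanned_indep (C : fieldType) (a b : C) (F G : bpoly C) N n
    (h : 'I_n -> bpoly C) :
  spanned a b F G N -> indep_mod a b F G h -> (n <= N)%N.
Proof.
move=> [k [s [hk hs]]] hi; apply: leq_trans hk; rewrite leqNgt; apply/negP => kn.
have /fin_all_exists [c hc] i : exists c : 'I_k -> C,
  loc_ideal a b F G (h i - \sum_j (c j)%:P%:P * s j) by apply: hs.
pose M : 'M[C]_(n, k) := \matrix_(i, j) c i j.
have : (0 < \rank (kermx M))%N.
  by rewrite mxrank_ker subn_gt0; apply: leq_ltn_trans kn; apply: rank_leq_col.
rewrite lt0n mxrank_eq0 => /rowV0Pn [v /sub_kermxP hv v0].
case/eqP: v0; apply/rowP => i; rewrite mxE; move: i; apply: hi.
have -> : \sum_i (v 0 i)%:P%:P * h i =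
   \sum_i (v 0 i)%:P%:P * (h i - \sum_j (c i j)%:P%:P * s j).
  under [RHS]eq_bigr do rewrite mulrBr; rewrite sumrB.
  rewrite -[LHS]subr0; congr (_ - _); apply/esym.
  under eq_bigr do rewrite mulr_sumr; rewrite exchange_big big1 //= => j _.
  under eq_bigr do rewrite mulrA -!polyCM.
  rewrite -mulr_suml -!rmorph_sum /=.
  have -> : \sum_i v 0 i * c i j = 0; last by rewrite !polyC0 mul0r.
  transitivity ((v *m M) 0 j); last by rewrite hv mxE.
  by rewrite mxE; apply: eq_bigr => i _; rewrite /M mxE.
by apply: loc_ideal_sum => i; apply: loc_idealMl.
Qed.

(** An independent family that does not span can be enlarged by a vector outside its span, so
    failure to span would give [N + 1] independent vectors. *)
Lemma spanned_of_indep_bound (C : fieldType) (a b : C) (F G : bpoly C) N :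
  (forall n (h : 'I_n -> bpoly C), indep_mod a b F G h -> (n <= N)%N) ->
  spanned a b F G N.
Proof.
move=> hN; apply: NNPP => hns.
suff /(_ N.+1) [h /hN] : forall n, exists h : 'I_n -> bpoly C, indep_mod a b F G h.
  by rewrite ltnn.
elim=> [|n [h hh]]; first by exists (fun=> 0) => c _ [].
have hn := hN _ _ hh.
have : exists P, ~ exists c : 'I_n -> C,
    loc_ideal a b F G (P - \sum_i (c i)%:P%:P * h i).
  by apply: not_all_ex_not => hs; apply: hns; exists n, h.
case=> P hP; exists (fun i => if unlift ord_max i is Some j then h j else P).
move=> c; rewrite big_ord_lift_max unlift_none.
under eq_bigr do rewrite liftK.
have [c0|c0] := eqVneq (c ord_max) 0.
  rewrite c0 !polyC0 mul0r addr0 => /hh hc i.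
  by case: (unliftP ord_max i) => [j|] ->.
move=> hl; case: hP; exists (fun i => - (c ord_max)^-1 * c (lift ord_max i)).
apply: (@loc_ideal_unit _ _ _ _ _ (c ord_max)%:P%:P); first by rewrite eval2C hornerC.
congr loc_ideal: hl.
rewrite addrC mulrBr; congr (_ + _); rewrite mulr_sumr -sumrN.
apply: eq_bigr => i _; rewrite mulrA -!polyCM -mulNr -!polyCN.
by congr (_%:P%:P * _); field.
Qed.

(* Dimension count in the spaces of polynomials of bounded bidegree: the
   syzygies of [F] and [P] are the multiples of [(P, -F)]. *)
Lemma bezout_indep (C : fieldType) (a b : C) (F P : bpoly C) e1 e2 n
    (h : 'I_n -> bpoly C) :
  F != 0 -> prime_elt F -> ~ divides F P -> bideg_le e1 e2 P ->
  indep_mod a b F P h -> (n <= degX F * e2 + degY F * e1)%N.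
Proof.
move=> F0 [_ hp] hFP hP hi; set d1 := degX F; set d2 := degY F.
have [K hK] : exists K, forall i, bideg_le K K (h i).
  pose f i := maxn (degX (h i)) (degY (h i)).
  exists (\max_i f i)%N => i.
  apply: (bideg_leW _ _ (@bideg_exact _ (h i)));
    by apply: leq_trans (leq_bigmax i); rewrite /f ?leq_maxl ?leq_maxr.
(* A triple [(c, A, B)] is sent to [sum c_i h_i + A F + B P]. The bidegree boxes for [A] and [B] are
   chosen so that both products land in the same target box. *)
pose U : vectType C := ('rV[C]_n * 'M[C]_((K + e2).+1, (K + e1).+1) *
            'M[C]_((K + d2).+1, (K + d1).+1))%type.
pose f (x : U) := mx_of_bpoly (K + d1 + e1).+1 (K + d2 + e2).+1
  (\sum_i (x.1.1 0 i)%:P%:P * h i + bpoly_of_mx x.1.2 * F + bpoly_of_mx x.2 * P).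
pose g (w : 'M[C]_(K.+1, K.+1)) : U :=
  (0, - mx_of_bpoly (K + e1).+1 (K + e2).+1 (bpoly_of_mx w * P),
   mx_of_bpoly (K + d1).+1 (K + d2).+1 (bpoly_of_mx w * F)).
have lf : linear f.
  move=> c x y; rewrite /f -mx_of_bpolyZ -mx_of_bpolyD; congr mx_of_bpoly.
  rewrite /= !bpoly_of_mxP.
  have -> : \sum_i ((c *: x + y).1.1 0 i)%:P%:P * h i =
     c%:P%:P * (\sum_i (x.1.1 0 i)%:P%:P * h i) + \sum_i (y.1.1 0 i)%:P%:P * h i.
    rewrite mulr_sumr -big_split; apply: eq_bigr => i _ /=.
    by rewrite !mxE !polyCD !polyCM; ring.
  move: (\sum_i _) (\sum_i _) => S T.
  move: (bpoly_of_mx _) (bpoly_of_mx _) (bpoly_of_mx _) (bpoly_of_mx _) c%:P%:P => ? ? ? ? ?.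
  by ring.
have lg : linear g.
  move=> c x y; rewrite /g bpoly_of_mxP; congr (_, _, _).
  - by rewrite /= scaler0 addr0.
  - by rewrite /= mulrDl -mulrA mx_of_bpolyD mx_of_bpolyZ opprD scalerN.
  - by rewrite /= mulrDl -mulrA mx_of_bpolyD mx_of_bpolyZ.
have hk u : f u = 0 -> exists w, u = g w.
  case: u => [[c A] B]; rewrite /f /= => h0.
  have {}h0 : \sum_i (c 0 i)%:P%:P * h i + bpoly_of_mx A * F + bpoly_of_mx B * P = 0.
    apply: mx_of_bpoly_inj h0; apply: bideg_leD; first apply: bideg_leD.
    - apply: bideg_le_sum => i; apply: (@bideg_leW _ K K); try lia.
      rewrite -[K]add0n; apply: bideg_leM => //.
      move=> k l; rewrite !coefC; case: k => [|k] /=; last by rewrite coef0 eqxx.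
      by rewrite coefC; case: l => //=; rewrite eqxx.
    - apply: (bideg_leW _ _ (bideg_leM (@bideg_bpoly_of_mx _ _ _ A) (@bideg_exact _ F)));
        by rewrite -/d1 -/d2; lia.
    - exact: bideg_leM (@bideg_bpoly_of_mx _ _ _ B) hP.
  have c0 : c = 0.
    apply/rowP => i; rewrite mxE; move: i; apply: hi.
    have -> : \sum_i (c 0 i)%:P%:P * h i = - (bpoly_of_mx A * F) - bpoly_of_mx B * P.
      apply: subr0_eq; rewrite -[RHS]h0; move: (\sum_i _) (_ * F) (_ * P) => S T V.
      by ring.
    by apply: loc_idealB; first apply: loc_idealN; apply: loc_idealMl;
      [apply: loc_ideal_l|apply: loc_ideal_r].
  rewrite c0 big1 ?add0r in h0; last by move=> i _; rewrite mxE !polyC0 mul0r.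
  (* Independence has removed [c]; what remains is [A F = - B P], and primality puts [F] in [B]. *)
  have [Q eQ] : divides F (bpoly_of_mx B).
    case: (@hp (bpoly_of_mx B) P) => //; exists (- bpoly_of_mx A).
    by rewrite mulNr; apply/eqP; rewrite -addr_eq0 addrC h0.
  have eA : bpoly_of_mx A = - (Q * P).
    apply: (mulIf F0); apply/eqP; rewrite mulNr -addr_eq0 mulrAC -eQ.
    by rewrite h0.
  have hQ : bideg_le K K Q.
    apply: (bideg_le_quotient F0); rewrite -eQ; exact: bideg_bpoly_of_mx.
  exists (mx_of_bpoly K.+1 K.+1 Q); rewrite /g mx_of_bpolyK //.
  have mxK u v (M N : 'M[C]_(v.+1, u.+1)) : bpoly_of_mx M = bpoly_of_mx N -> M = N.
    move=> e; apply/matrixP => j i.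
    have := congr1 (fun R : bpoly C => R`_j`_i) e; rewrite !coef_bpoly_of_mx.
    have E (L : 'M[C]_(v.+1, u.+1)) :
        \sum_k \sum_l L k l *+ ((j == k :> nat) && (i == l :> nat)) = L j i.
      rewrite (bigD1 j) //= [X in _ + X]big1 => [|k hk'].
        rewrite addr0 (bigD1 i) //= [X in _ + X]big1 => [|l hl].
          by rewrite !eqxx mulr1n addr0.
        have -> : (i == l :> nat) = false by apply/negbTE; rewrite eq_sym.
        by rewrite andbF.
      rewrite big1 // => l _.
      by have -> : (j == k :> nat) = false by apply/negbTE; rewrite eq_sym.
    by rewrite !E.
  congr (_, _, _) => //; apply: mxK.
    rewrite -[- _]scaleN1r -mx_of_bpolyZ mx_of_bpolyK; first by rewrite eA !polyCN mulN1r.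
    rewrite !polyCN mulN1r; apply: bideg_leN; exact: bideg_leM hQ hP.
  by rewrite eQ mx_of_bpolyK // ; apply: bideg_leM hQ (@bideg_exact _ F).
have := dim_le_of_kernel lf lg hk.
have -> : dim U = (1 * n + (K + e2).+1 * (K + e1).+1 + (K + d2).+1 * (K + d1).+1)%N.
  by [].
(* The four box dimensions are quadratic in [K]; all terms in [K] cancel and only the mixed products
   remain. *)
rewrite !dim_matrix; nia.
Qed.

(** * Constants of a derivation and prime polynomials *)

(** Gaussian elimination without fractions: a pivot row clears the first column by cross
    multiplication, and its own coefficient in the relation is set so that the first column sums to
    0. *)
Lemma left_kernel_idomain (R : idomainType) n (M : 'I_n.+1 -> 'I_n -> R) :
  exists v : 'I_n.+1 -> R, (exists i, v i != 0) /\
    forall j, \sum_i v i * M i j = 0.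
Proof.
elim: n M => [|n IH] M.
  by exists (fun=> 1); split=> [|[]//]; exists ord0; apply: oner_neq0.
case: (pickP (fun i => M i ord0 != 0)) => [i0 p0|hz].
  have [v [[k vk] hv]] := IH (fun i j =>
    M i0 ord0 * M (lift i0 i) (lift ord0 j) - M (lift i0 i) ord0 * M i0 (lift ord0 j)).
  pose w i := if unlift i0 i is Some i' then M i0 ord0 * v i'
              else - \sum_i' v i' * M (lift i0 i') ord0.
  have wl i : w (lift i0 i) = M i0 ord0 * v i by rewrite /w liftK.
  have w0 : w i0 = - \sum_i' v i' * M (lift i0 i') ord0 by rewrite /w unlift_none.
  have sumw j : \sum_i w i * M i j =
     \sum_i v i * (M i0 ord0 * M (lift i0 i) j - M (lift i0 i) ord0 * M i0 j).
    rewrite (bigD1_ord i0) //= w0 mulNr mulr_suml -sumrN -big_split /=.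
    by apply: eq_bigr => i _; rewrite wl; ring.
  exists w; split; first by exists (lift i0 k); rewrite wl mulf_neq0.
  move=> j; rewrite sumw; case: (unliftP ord0 j) => [j' ->|->]; first exact: hv.
  by rewrite big1 // => i _; ring.
have [v [[k vk] hv]] := IH (fun i j => M (lift ord0 i) (lift ord0 j)).
exists (fun i => if unlift ord0 i is Some i' then v i' else 0); split.
  by exists (lift ord0 k); rewrite liftK.
move=> j; rewrite (bigD1_ord ord0) //= unlift_none mul0r add0r.
under eq_bigr do rewrite liftK.
case: (unliftP ord0 j) => [j' ->|->]; first exact: hv.
by rewrite big1 // => i _; move/negbFE/eqP: (hz (lift ord0 i)) => ->; rewrite mulr0.
Qed.

(** The binary form [B^n r(A / B)]. *)
Definition homog (C : fieldType) n (A B : bpoly C) (r : {poly C}) : bpoly C :=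
  \sum_(j < n.+1) (r`_j)%:P%:P * (A ^+ j * B ^+ (n - j)).

Lemma homog_mulX (C : fieldType) n (A B : bpoly C) (r : {poly C}) :
  homog n.+1 A B ('X * r) = A * homog n A B r.
Proof.
rewrite /homog big_ord_recl /= coefXM eqxx !polyC0 mul0r add0r mulr_sumr.
apply: eq_bigr => j _; rewrite coefXM /= /bump leq0n add1n subSS exprS; ring.
Qed.

Lemma homog_pad (C : fieldType) n (A B : bpoly C) (r : {poly C}) :
  (size r <= n.+1)%N -> homog n.+1 A B r = B * homog n A B r.
Proof.
move=> hr; rewrite /homog big_ord_recr /= [r`_n.+1]nth_default // !polyC0 mul0r addr0.
rewrite mulr_sumr; apply: eq_bigr => j _.
by rewrite subSn ?exprS; [ring|rewrite -ltnS].
Qed.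

Lemma homogB (C : fieldType) n (A B : bpoly C) c (r s : {poly C}) :
  homog n A B (r - c *: s) = homog n A B r - c%:P%:P * homog n A B s.
Proof.
rewrite /homog mulr_sumr -sumrB; apply: eq_bigr => j _.
by rewrite coefB coefZ !polyCB !polyCM; ring.
Qed.

(** Over a closed field the form splits into factors [A - c B] and, when the degree of [r] drops,
    factors [B]; the prime [F] must divide one of the former. *)
Lemma homog_prime_factor (C : closedFieldType) (F A B : bpoly C) n (r : {poly C}) :
  prime_elt F -> ~ divides F B -> r != 0 -> (size r <= n.+1)%N ->
  divides F (homog n A B r) -> exists c, divides F (A - c%:P%:P * B).
Proof.
move=> [hF1 hp] hB; elim: n r => [|n IH] r r0 hr.
  have e : r = (r`_0)%:P by apply: size1_polyC.
  have c0 : r`_0 != 0 by apply: contraNneq r0 => h; rewrite e h polyC0.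
  rewrite /homog big_ord1 !expr0 !mulr1 => /(dividesMl (r`_0)^-1%:P%:P).
  by rewrite -!polyCM mulVf.
have [hs|hs] := leqP (size r) n.+1.
  by rewrite homog_pad // => /hp [//|]; apply: IH.
have /closed_rootP [c /factor_theorem [s es]] : size r != 1%N by lia.
have s0 : s != 0 by apply: contraNneq r0 => h; rewrite es h mul0r.
have ss : (size s <= n.+1)%N.
  by move: hr; rewrite es size_Mmonic ?monicXsubC // size_XsubC addn2.
have -> : homog n.+1 A B r = (A - c%:P%:P * B) * homog n A B s.
  have -> : r = 'X * s - c *: s by rewrite es mulrBr -mul_polyC; ring.
  by rewrite homogB homog_mulX homog_pad //; ring.
by case/hp => [h|]; [exists c|apply: IH].
Qed.

Lemma derivation_polyC (C : fieldType) (E : bpoly C -> bpoly C) :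
  derivation E -> (forall c : C, E c%:P%:P = 0) ->
  forall f : {poly C}, E f%:P = (f^`())%:P * E 'X%:P.
Proof.
move=> hE hc; elim/poly_ind => [|f c IH].
  by rewrite deriv0 !polyC0 mul0r (derivation0 hE).
have -> : (f * 'X + c%:P)^`() = f^`() * 'X + f.
  by rewrite derivD derivM derivX derivC mulr1 addr0.
by rewrite !polyCD !polyCM (proj1 hE) (proj2 hE) hc IH; ring.
Qed.

(** When [A / B] has zero derivative modulo [F], all products of [j + k] factors [A] or [B] have the
    same logarithmic derivative, that of [B^(j+k)]. *)
Lemma divides_logderiv (R : comNzRingType) (E : R -> R) (F A B : R) j k :
  derivation E -> divides F (B * E A - A * E B) ->
  divides F (B * E (A ^+ j * B ^+ k) - (A ^+ j * B ^+ k * E B) *+ (j + k)).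
Proof.
move=> hE hAB.
have -> : B * E (A ^+ j * B ^+ k) - (A ^+ j * B ^+ k * E B) *+ (j + k) =
   (A ^+ j.-1 * B ^+ k *+ j) * (B * E A - A * E B).
  rewrite (proj2 hE) !(derivationX _ _ hE) mulrnDr.
  have hA : A * A ^+ j.-1 *+ j = A ^+ j *+ j by case: j => [|j]; rewrite -?exprS.
  have hB : B * B ^+ k.-1 *+ k = B ^+ k *+ k by case: k => [|k]; rewrite -?exprS.
  have -> : (A ^+ j * B ^+ k * E B) *+ j = (A * A ^+ j.-1 *+ j) * B ^+ k * E B.
    by rewrite hA -!mulrnAl.
  have -> : (A ^+ j * B ^+ k * E B) *+ k = A ^+ j * (B * B ^+ k.-1 *+ k) * E B.
    by rewrite hB -mulrnAl -mulrnAr.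
  ring.
exact: dividesMl.
Qed.

(** [A / B] is algebraic over the rational functions of [x], because [F] has finite degree [n] in
    [y]. Differentiation lowers the degrees of the coefficients of an algebraic relation until they
    are scalars; the relation then splits into linear factors. *)
Lemma const_lemma_gen (C : numClosedFieldType) (E : bpoly C -> bpoly C)
    (F : bpoly C) :
  derivation E -> (forall c : C, E c%:P%:P = 0) -> divides F (E F) ->
  prime_elt F -> F != 0 -> ~ divides F (E 'X%:P) -> const_lemma E F.
Proof.
move=> hE hc hEF hF F0 hX A B hB hAB; have [_ hp] := hF.
pose n := (size F).-1.
have szF : size F = n.+1 by rewrite /n prednK // size_poly_gt0.
pose P (j : 'I_n.+1) := A ^+ j * B ^+ (n - j).
have [R [[j0 R0] hR]] : exists R : 'I_n.+1 -> {poly C}, (exists j, R j != 0) /\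
    divides F (\sum_j (R j)%:P * P j).
  (* The [n + 1] remainders modulo [F] have only [n] coefficients in [y]. Pseudo-division accounts
     for the powers of the leading coefficient in the witness. *)
  have [v [[k vk] hv]] := left_kernel_idomain (fun j (i : 'I_n) => (P j %% F)`_i).
  exists (fun j => v j * lead_coef F ^+ scalp (P j) F); split.
    by exists k; rewrite mulf_neq0 // expf_neq0 // lead_coef_eq0.
  exists (\sum_j (v j)%:P * (P j %/ F)).
  have hr : \sum_j (v j)%:P * (P j %% F) = 0.
    apply/polyP => i; rewrite coef0 coef_sum.
    under eq_bigr do rewrite coefCM.
    have [hi|hi] := leqP n i; last exact: (hv (Ordinal hi)).
    rewrite big1 // => j _; rewrite nth_default ?mulr0 //.
    by apply: leq_trans hi; rewrite -ltnS -szF ltn_modp.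
  transitivity (\sum_j ((v j)%:P * (P j %/ F) * F + (v j)%:P * (P j %% F))).
    apply: eq_bigr => j _.
    rewrite polyCM -mulrA [(_ ^+ _)%:P * _]mul_polyC.
    by rewrite Pdiv.Idomain.divp_eq mulrDr mulrA.
  by rewrite big_split /= hr addr0 mulr_suml.
have [r [r0 hr]] : exists r : 'I_n.+1 -> C, (exists j, r j != 0) /\
    divides F (\sum_j (r j)%:P%:P * P j).
  have [s hs] : exists s, forall j, (size (R j) <= s)%N.
    by exists (\max_j size (R j))%N => j; apply: leq_bigmax.
  elim: s R j0 R0 hR hs => [|s IH] R j0 R0 hR hs.
    by have := hs j0; rewrite leqn0 size_poly_eq0 (negPf R0).
  case: (pickP (fun j => (R j)^`() != 0)) => [j1 R1|hz].
    apply: (IH (fun j => (R j)^`()) j1) => // [|j]; last first.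
      have [->|Rj] := eqVneq (R j) 0; first by rewrite deriv0 size_poly0.
      by rewrite -ltnS; apply: leq_trans (lt_size_deriv Rj) (hs j).
    have hES := dividesMl B (divides_derivation hE hEF hR).
    (* The products [P j] share one logarithmic derivative, so its contribution is a multiple of the
       relation itself; only the derivatives of the [R j] survive. *)
    have : divides F (B * E 'X%:P * \sum_j ((R j)^`())%:P * P j).
      have h1 : divides F (\sum_j (R j)%:P * (B * E (P j) - (P j * E B) *+ n)).
        apply: divides_sum => j; apply: dividesMl.
        have := divides_logderiv j (n - j) hE hAB.
        by rewrite subnKC // -ltnS.
      have h2 := dividesMl (E B *+ n) hR.
      have := dividesB (dividesB hES h1) h2.
      congr divides; rewrite derivation_sum // !mulr_sumr -!sumrB.
      apply: eq_bigr => j _; rewrite (proj2 hE) (derivation_polyC hE hc).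
      by rewrite -[_ *+ n]mulr_natr -[E B *+ n]mulr_natr; ring.
    by case/hp => // /hp [].
  (* All derivatives vanish; in characteristic 0 the coefficients are scalars. *)
  have RC j : R j = ((R j)`_0)%:P.
    apply/polyP => -[|i]; rewrite coefC //=.
    have := congr1 (fun p : {poly C} => p`_i) (eqP (negbFE (hz j))).
    by rewrite coef_deriv coef0 => /eqP; rewrite mulrn_eq0 => /eqP.
  exists (fun j => (R j)`_0); split.
    by exists j0; apply: contraNneq R0 => h; rewrite RC h polyC0.
  by under eq_bigr do rewrite -RC.
apply: (@homog_prime_factor _ F A B n (\poly_(j < n.+1) r (inord j))) => //.
- case: r0 => j rj; apply: contraNneq rj => h.
  have := congr1 (fun p : {poly C} => p`_j) h.
  by rewrite coef_poly ltn_ord coef0 inord_val => ->.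
- congr divides: hr; apply: eq_bigr => j _.
  by rewrite coef_poly ltn_ord inord_val.
Qed.

Definition evalX (C : fieldType) (a : C) (P : bpoly C) : {poly C} :=
  (swapXY P).[a%:P].

Lemma evalXM (C : fieldType) (a : C) (P Q : bpoly C) :
  evalX a (P * Q) = evalX a P * evalX a Q.
Proof. by rewrite /evalX rmorphM hornerM. Qed.

Lemma evalXB (C : fieldType) (a : C) (P Q : bpoly C) :
  evalX a (P - Q) = evalX a P - evalX a Q.
Proof. by rewrite /evalX rmorphB hornerD hornerN. Qed.

Lemma evalXC (C : fieldType) (a : C) (f : {poly C}) :
  evalX a f%:P = (f.[a])%:P.
Proof.
by rewrite /evalX swapXY_polyC (horner_map (polyC : {rmorphism C -> {poly C}})).
Qed.

Lemma swap_lineY (C : fieldType) (a : C) : swapXY (lineY a) = lineX a.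
Proof.
by rewrite /lineY /lineX rmorphB /= swapXY_X swapXY_polyC map_polyC polyCB.
Qed.

Lemma divides_lineXP (C : fieldType) (a : C) (P : bpoly C) :
  divides (lineX a) P <-> evalX a P = 0.
Proof.
split=> [[Q ->]|].
  by rewrite evalXM evalXC !hornerE subrr mulr0.
case/divides_lineY => Q eQ; exists (swapXY Q).
by rewrite -[LHS]swapXYK eQ rmorphM /= swap_lineY mulrC.
Qed.

Lemma lineX_neq0 (C : fieldType) (a : C) : lineX a != 0.
Proof. by rewrite /lineX polyC_eq0 polyXsubC_eq0. Qed.

Lemma degX_lineX (C : fieldType) (a : C) : degX (lineX a) = 1%N.
Proof. by rewrite /degX sizeYE -swap_lineY swapXYK size_XsubC. Qed.

Lemma degY_polyC (C : fieldType) (f : {poly C}) : degY f%:P = 0%N.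
Proof. by rewrite /degY size_polyC; case: (f != 0). Qed.

Lemma prime_lineX (C : fieldType) (a : C) : prime_elt (lineX a).
Proof.
split=> [|P Q].
  by rewrite divides_lineXP -[1]polyC1 evalXC hornerC => /eqP; rewrite polyC_eq0 oner_eq0.
rewrite !divides_lineXP evalXM => /eqP; rewrite mulf_eq0.
by case/orP => /eqP; [left|right].
Qed.

(** Scalars, including 0, satisfy this too; positive degree is required separately where it
    matters. *)
Definition irreducible_bpoly (C : fieldType) (F : bpoly C) : Prop :=
  forall A B, F = A * B ->
    (degX A + degY A = 0)%N \/ (degX B + degY B = 0)%N.

(** Each root [a] of [c] gives a prime [x - a] that divides [Q F] but not [F], hence divides [Q];
    roots are cancelled one at a time. *)
Lemma clear_content (C : closedFieldType) (c : {poly C}) (P Q F : bpoly C) :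
  c != 0 -> (forall a, ~ divides (lineX a) F) ->
  c%:P * P = Q * F -> divides F P.
Proof.
move=> c0 hF; move: {2}(size c) (leqnn (size c)) => n.
elim: n c c0 Q => [|n IH] c c0 Q hc e.
  by move: hc; rewrite leqn0 size_poly_eq0 (negPf c0).
have [hs|/closed_rootP [a /factor_theorem [c' ec]]] := eqVneq (size c) 1%N.
  have /size_poly1P [k k0 ek] : size c == 1%N by rewrite hs.
  exists (k^-1%:P%:P * Q); rewrite -mulrA -e ek mulrA -!polyCM mulVf //.
  by rewrite mul1r.
have [|[Q' eQ]|/hF //] := proj2 (prime_lineX a) Q F.
  by rewrite -e; exists (c'%:P * P); rewrite ec polyCM /lineX; ring.
have c'0 : c' != 0 by apply: contraNneq c0 => h; rewrite ec h mul0r.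
apply: (IH c' c'0 Q').
  by move: hc; rewrite ec size_Mmonic ?monicXsubC // size_XsubC addn2.
apply: (mulfI (lineX_neq0 a)).
have -> : lineX a * (c'%:P * P) = c%:P * P by rewrite ec polyCM /lineX; ring.
by rewrite e eQ; ring.
Qed.

(** Gauss's lemma: each prime [x - a] dividing [c] is cancelled from [Q] or from [G], which leaves
    the degree in [y] unchanged. *)
Lemma gauss_factor (C : closedFieldType) (c : {poly C}) (F Q G : bpoly C) :
  c != 0 -> c%:P * F = Q * G ->
  exists A B, [/\ F = A * B, size A = size Q & size B = size G].
Proof.
move=> c0; move: {2}(size c) (leqnn (size c)) => n.
elim: n c c0 Q G => [|n IH] c c0 Q G hc e.
  by move: hc; rewrite leqn0 size_poly_eq0 (negPf c0).
have [hs|/closed_rootP [a /factor_theorem [c' ec]]] := eqVneq (size c) 1%N.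
  have /size_poly1P [k k0 ek] : size c == 1%N by rewrite hs.
  have k0' : (k^-1)%:P != 0 :> {poly C} by rewrite polyC_eq0 invr_eq0.
  exists ((k^-1)%:P *: Q), G; split=> //; last by rewrite size_scale.
  rewrite -scalerAl -e ek mul_polyC scalerA -polyCM mulVf //.
  by rewrite scale1r.
have c'0 : c' != 0 by apply: contraNneq c0 => h; rewrite ec h mul0r.
have hc' : (size c' <= n)%N.
  by move: hc; rewrite ec size_Mmonic ?monicXsubC // size_XsubC addn2.
have eF : lineX a * (c'%:P * F) = c%:P * F by rewrite ec polyCM /lineX; ring.
have szl (P : bpoly C) : size (P * lineX a) = size P.
  by rewrite mulrC /lineX mul_polyC size_scale // polyXsubC_eq0.
have [|[Q' eQ]|[G' eG]] := proj2 (prime_lineX a) Q G.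
- by rewrite -e -eF mulrC; exists (c'%:P * F).
- have [|A [B [h1 h2 h3]]] := IH c' c'0 Q' G hc'.
    by apply: (mulfI (lineX_neq0 a)); rewrite eF e eQ; ring.
  by exists A, B; rewrite eQ szl.
- have [|A [B [h1 h2 h3]]] := IH c' c'0 Q G' hc'.
    by apply: (mulfI (lineX_neq0 a)); rewrite eF e eG; ring.
  by exists A, B; rewrite eG szl.
Qed.

(** [F] stays irreducible over the rational functions of [x], so it is coprime there to whatever it
    does not divide; Gauss's divisibility lemma applies, and [clear_content] returns to
    polynomials. *)
Lemma irreducible_prime (C : closedFieldType) (F : bpoly C) :
  (0 < degY F)%N -> irreducible_bpoly F -> prime_elt F.
Proof.
move=> dF hirr.
have F0 : F != 0 by apply: contraTneq dF => ->; rewrite /degY size_poly0.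
have hF a : ~ divides (lineX a) F.
  case=> Q eQ; have Q0 : Q != 0 by apply: contraNneq F0 => h; rewrite eQ h mul0r.
  move: dF; rewrite eQ degYM ?lineX_neq0 // degY_polyC addn0.
  by case: (hirr _ _ eQ); rewrite ?degX_lineX //; lia.
have hdvd P : F %| P -> divides F P.
  case/Pdiv.Idomain.dvdpP => -[c Q] /= c0; rewrite -mul_polyC.
  exact: clear_content.
have hcop P : ~ divides F P -> coprimep F P.
  move=> hP; rewrite coprimep_def; apply/negPn/negP => hg.
  have := Pdiv.Idomain.dvdp_gcdl F P; have := Pdiv.Idomain.dvdp_gcdr F P.
  move: (gcdp F P) hg => g hg.
  case/Pdiv.Idomain.dvdpP => -[c' q'] /= c'0 eP /Pdiv.Idomain.dvdpP [[c q] /= c0 eF].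
  rewrite -mul_polyC in eP; rewrite -mul_polyC in eF.
  have g0 : g != 0.
    apply: contraNneq F0 => h; move: eF; rewrite h mulr0 => /eqP.
    by rewrite mulf_eq0 polyC_eq0 (negPf c0).
  have [A [B [eAB sA sB]]] := gauss_factor c0 eF.
  (* Either the cofactor [q] of the gcd is free of [y], and then [F] divides [P] after clearing
     contents, or the gcd itself is free of [y]. *)
  case: (hirr _ _ eAB) => h.
    have q1 : (size q <= 1)%N.
      rewrite -sA; move/eqP: h; rewrite addn_eq0 => /andP[_].
      by rewrite /degY; case: (size A) => [|[]].
    have eq : q = (q`_0)%:P by apply: size1_polyC.
    have q0 : q`_0 != 0.
      apply: contraNneq F0 => h0; move: eF; rewrite eq h0 polyC0 mul0r => /eqP.
      by rewrite mulf_eq0 polyC_eq0 (negPf c0).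
    apply: hP; apply: (@clear_content _ (q`_0 * c') P (q' * c%:P)) => //.
      by rewrite mulf_neq0.
    by rewrite -mulrA eF [in RHS]eq polyCM -mulrA eP; ring.
  move: h; rewrite /degY sB => /eqP; rewrite addn_eq0 => /andP[_ h].
  by move: hg g0 h; rewrite -size_poly_gt0; case: (size g) => [|[]].
split.
  case=> Q eQ; have Q0 : Q != 0.
    by apply/eqP => h; move/eqP: eQ; rewrite h mul0r oner_eq0.
  have := congr1 (@degY C) eQ; rewrite degYM // -polyC1 degY_polyC.
  by move/esym/eqP; rewrite addn_eq0 => /andP[_ /eqP h]; rewrite h in dF.
move=> P Q hPQ; case: (classic (divides F P)) => hP; [by left|right].
apply: hdvd; rewrite -(Pdiv.Idomain.Gauss_dvdpr _ (hcop _ hP)).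
case: hPQ => T ->; exact: Pdiv.Idomain.dvdp_mull.
Qed.

Lemma coef_mul_top (R : comNzRingType) (p q : {poly R}) m n :
  (size p <= m.+1)%N -> (size q <= n.+1)%N -> (p * q)`_(m + n) = p`_m * q`_n.
Proof.
move=> hp hq; rewrite coefM (bigD1 (inord m)) //= inordK ?ltnS ?leq_addr //.
rewrite addKn big1 ?addr0 // => i hi.
have {}hi : (i : nat) != m.
  by apply: contraNneq hi => e; apply/eqP/val_inj; rewrite /= inordK ?ltnS ?leq_addr.
have [h|h] := ltnP m i.
  by rewrite nth_default ?mul0r //; apply: leq_trans hp h.
by rewrite [q`_ _]nth_default ?mulr0 //; apply: leq_trans hq _; lia.
Qed.

(** Subtract the multiple of [q] that removes the coefficient of [p] in degree [m]. A nonzero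
    difference [d] satisfies the same equation, and the top coefficients there force its degree to
    be [m], where its coefficient was removed. *)
Lemma proportional_of_wronskian0 (C : numFieldType) (p q : {poly C}) :
  q != 0 -> q * euler p = p * euler q -> exists c, p = c *: q.
Proof.
move=> q0 e; pose m := (size q).-1.
have lq : q`_m != 0 by rewrite -[q`_m]/(lead_coef q) lead_coef_eq0.
exists (p`_m / q`_m); apply/eqP; rewrite -subr_eq0; apply/negPn/negP.
set d := p - _ => d0; pose n := (size d).-1.
have ld : d`_n != 0 by rewrite -[d`_n]/(lead_coef d) lead_coef_eq0.
have dm : d`_m = 0 by rewrite /d coefB coefZ divfK // subrr.
have ed : q * euler d = d * euler q.
  by rewrite /d /euler !derivE; move: e; rewrite /euler => e;
    rewrite mulrBr mulrBr e; rewrite -!mul_polyC; ring.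
have sz (r : {poly C}) : (size r <= (size r).-1.+1)%N by exact: leqSpred.
have sze (r : {poly C}) : (size (euler r) <= (size r).-1.+1)%N.
  apply/leq_sizeP => i hi; rewrite coef_euler nth_default ?mul0rn //.
  exact: leq_trans (sz r) hi.
have := congr1 (fun r : {poly C} => r`_(m + n)) ed; rewrite /=.
rewrite coef_mul_top // addnC coef_mul_top // !coef_euler.
rewrite mulrnAr mulrnAr [d`_n * _]mulrC => /eqP.
have nz : q`_m * d`_n != 0 by rewrite mulf_neq0.
rewrite -(mulr_natr _ n) -(mulr_natr _ m) (inj_eq (mulfI nz)) eqr_nat => /eqP nm.
by move: ld; rewrite nm dm eqxx.
Qed.

(** * Multiplicity along a prime factor *)

Definition isolated (C : fieldType) (a b : C) (F G : bpoly C) : Prop :=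
  exists k m, loc_ideal a b F G (lineX a ^+ k) /\
              loc_ideal a b F G (lineY b ^+ m).

Lemma isolated_sub (C : fieldType) (a b : C) (F G F' G' : bpoly C) :
  loc_ideal a b F' G' F -> loc_ideal a b F' G' G ->
  isolated a b F G -> isolated a b F' G'.
Proof.
move=> hF hG [k [m [h1 h2]]]; exists k, m.
by split; [apply: loc_ideal_sub h1|apply: loc_ideal_sub h2].
Qed.

Lemma eval2_lineX (C : fieldType) (a b : C) : eval2 (lineX a) a b = 0.
Proof. by rewrite eval2C !hornerE subrr. Qed.

Lemma eval2_lineY (C : fieldType) (a b : C) : eval2 (lineY b) a b = 0.
Proof. by rewrite /eval2 eval_lineY horner0. Qed.

Lemma eval2_0_lines (C : fieldType) (a b : C) (P : bpoly C) :
  eval2 P a b = 0 -> exists A B, P = A * lineX a + B * lineY b.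
Proof.
have [Q eP] := split_lineY b P; move/eqP => h.
have /factor_theorem [f ef] : root P.[b%:P] a by exact: h.
by exists f%:P, Q; rewrite {1}eP ef polyCM /lineX; ring.
Qed.

Lemma isolated_nilpotent (C : fieldType) (a b : C) (F G T : bpoly C) :
  isolated a b F G -> eval2 T a b = 0 -> exists n, loc_ideal a b F G (T ^+ n).
Proof.
move=> [k [m [hX hY]]] /eval2_0_lines [A [B ->]]; exists (k + m)%N.
rewrite exprDn; apply: loc_ideal_sum => i; rewrite -mulr_natl; apply: loc_idealMl.
rewrite !exprMn; have [hi|hi] := leqP m i.
  have -> : lineY b ^+ i = lineY b ^+ (i - m) * lineY b ^+ m.
    by rewrite -exprD subnK.
  by rewrite !mulrA; apply: loc_idealMl.
have -> : lineX a ^+ (k + m - i) = lineX a ^+ (k + m - i - k) * lineX a ^+ k.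
  by rewrite -exprD subnK //; lia.
by rewrite mulrC !mulrA; apply: loc_idealMl.
Qed.

(** A polynomial nonzero at the point is a nonzero scalar minus a nilpotent modulo the ideal, so a
    finite geometric sum inverts it. *)
Lemma isolated_inverse (C : fieldType) (a b : C) (F G U : bpoly C) :
  isolated a b F G -> eval2 U a b != 0 ->
  exists V, loc_ideal a b F G (U * V - 1).
Proof.
move=> hI U0; set u := eval2 U a b.
have [n hn] : exists n, loc_ideal a b F G ((u%:P%:P - U) ^+ n).
  apply: isolated_nilpotent hI _.
  by rewrite /eval2 hornerD hornerN hornerC hornerD hornerN hornerC; apply: subrr.
have := subrXX (u%:P%:P) (u%:P%:P - U) n; rewrite subKr.
set S := \sum_i _ => e; exists ((u^-1 ^+ n)%:P%:P * S).
have -> : U * ((u^-1 ^+ n)%:P%:P * S) - 1 =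
  - ((u^-1 ^+ n)%:P%:P * (u%:P%:P - U) ^+ n).
  rewrite mulrCA -e addrC mulrDr mulrN -!polyC_exp -!polyCM -exprMn mulVf //.
  by rewrite expr1n !polyC1 addKr.
by apply: loc_idealN; apply: loc_idealMl.
Qed.

(** Right exactness: multiplication by [F1] maps the quotient by [(F2, G)] onto the kernel of the
    map from the quotient by [(F1 F2, G)] to the one by [(F1, G)]. The polynomial inverse [V]
    absorbs the denominator of the first reduction. *)
Lemma spannedM (C : fieldType) (a b : C) (F1 F2 G : bpoly C) N1 N2 :
  isolated a b (F1 * F2) G -> spanned a b F1 G N1 -> spanned a b F2 G N2 ->
  spanned a b (F1 * F2) G (N1 + N2).
Proof.
move=> hI [k1 [s1 [hk1 hs1]]] [k2 [s2 [hk2 hs2]]].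
exists (k1 + k2)%N, (fun i => match split i with inl i1 => s1 i1 | inr i2 => F1 * s2 i2 end).
split=> [|P]; first exact: leq_add.
have [c1 [U [A [B [U0 e]]]]] := hs1 P.
have [V hV] := isolated_inverse hI U0.
have [c2 h2] := hs2 (V * A).
exists (fun i => match split i with inl i1 => c1 i1 | inr i2 => c2 i2 end).
rewrite big_split_ord /=.
under eq_bigr do rewrite (unsplitK (inl _)).
under [X in _ - (_ + X)]eq_bigr do rewrite (unsplitK (inr _)) mulrCA.
rewrite -mulr_sumr; move: (\sum_i _) e (\sum_i _) h2 => S1 e S2 h2.
have -> : P - (S1 + F1 * S2) =
  - (P - S1) * (U * V - 1) + (F1 * (V * A - S2) + V * B * G).
  have -> : - (P - S1) * (U * V - 1) = (P - S1) - V * (U * (P - S1)) by ring.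
  by rewrite e; ring.
apply: loc_idealD; first exact: loc_idealMl.
apply: loc_idealD; last exact/loc_idealMl/loc_ideal_r.
apply: loc_ideal_sub (loc_ideal_scale F1 h2); first exact: loc_ideal_l.
exact/loc_idealMl/loc_ideal_r.
Qed.

Lemma prime_eltX (R : comNzRingType) (F P : R) n :
  prime_elt F -> divides F (P ^+ n) -> divides F P.
Proof.
move=> [h1 hp]; elim: n => [|n IH]; first by rewrite expr0.
by rewrite exprS => /hp [].
Qed.

Lemma deg0_const (C : fieldType) (F : bpoly C) :
  degX F = 0%N -> degY F = 0%N -> F = (F`_0`_0)%:P%:P.
Proof.
move=> h1 h2; have := @bideg_exact _ F; rewrite h1 h2 => h.
apply/polyP => j; apply/polyP => i; rewrite coefC.
case: j => [|j] /=; last first.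
  by rewrite coef0; apply/eqP/negPn/negP => /h; rewrite andbF.
by rewrite coefC; case: i => [|i] //=; apply/eqP/negPn/negP => /h.
Qed.

(** Otherwise the ideal is [(F)], and the prime [F] divides both lines [x = a] and [y = b]; it then
    has degree 0 in both variables and cannot vanish at the point. *)
Lemma isolated_not_divides (C : fieldType) (a b : C) (F G : bpoly C) :
  prime_elt F -> F != 0 -> eval2 F a b = 0 -> isolated a b F G -> ~ divides F G.
Proof.
move=> hF F0 Fp [k [m [hX hY]]] [Q eG].
have hdiv L n : loc_ideal a b F G (L ^+ n) -> divides F L.
  case=> U [A [B [U0 e]]]; apply: (@prime_eltX _ F L n) => //.
  have : divides F (U * L ^+ n) by exists (A + B * Q); rewrite e eG; ring.
  case/(proj2 hF) => // -[T eT]; move: U0.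
  by rewrite eT eval2M Fp mulr0 eqxx.
have [A eA] := hdiv _ _ hX; have [B eB] := hdiv _ _ hY.
have A0 : A != 0 by apply/eqP => h; move: (lineX_neq0 a); rewrite eA h mul0r eqxx.
have B0 : B != 0 by apply/eqP => h; move: (lineY_neq0 b); rewrite eB h mul0r eqxx.
have dY : degY F = 0%N.
  have := degYM A0 F0; rewrite -eA degY_polyC => /esym/eqP.
  by rewrite addn_eq0 => /andP[_ /eqP].
have dX : degX F = 0%N.
  have := degXM B0 F0; rewrite -eB /degX [in LHS]sizeYE swap_lineY.
  rewrite -[(size (lineX b)).-1]/(degY (lineX b)) degY_polyC => /esym/eqP.
  by rewrite addn_eq0 => /andP[_ /eqP].
move: (F`_0`_0) (deg0_const dX dY) => c eF; move: F0 Fp.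
by rewrite eF eval2C hornerC => /eqP F0 c0; apply: F0; rewrite c0 !polyC0.
Qed.

Lemma eval2_prod (C : fieldType) (a b : C) (I : finType) (P : I -> bpoly C) :
  (forall i, eval2 (P i) a b != 0) -> eval2 (\prod_i P i) a b != 0.
Proof.
move=> h; elim/big_ind: _ => //; first by rewrite eval2_1 oner_neq0.
by move=> P1 P2; rewrite eval2M; apply: mulf_neq0.
Qed.

Lemma eval2_monom (C : fieldType) (a b : C) i j :
  a != 0 -> b != 0 -> eval2 (monom C i j) a b != 0.
Proof.
move=> a0 b0; rewrite eval2M eval2C eval2X hornerXn.
by rewrite /eval2 hornerX hornerC mulf_neq0 // expf_neq0.
Qed.

(** [G] is a combination of monomials only modulo [F], since eliminating a monomial changes it by a
    multiple of [F]; this makes the induction on [t] go through. *)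
Lemma spanned_prime (C : fieldType) (a b : C) (F G L : bpoly C) t
    (e : 'I_t -> nat * nat) (c : 'I_t -> C) :
  a != 0 -> b != 0 -> F != 0 -> eval2 F a b = 0 -> prime_elt F ->
  L = lineX a \/ L = lineY b -> const_lemma (fun P => L * jac F P) F ->
  isolated a b F G ->
  divides F (G - \sum_k (c k)%:P%:P * monom C (e k).1 (e k).2) ->
  spanned a b F G ('C(t, 2) * (2 * degX F * degY F + degX F + degY F)).
Proof.
move=> a0 b0 F0 Fp hF hL hc hI; have [hF1 hp] := hF.
have hGF := isolated_not_divides hF F0 Fp hI.
set E := fun P => L * jac F P in hc *.
have EF : divides F (E F).
  by rewrite /E jacFF mulr0; apply: divides0.
elim: t e c => [|t IH] e c hG.
  by case: hGF; rewrite big_ord0 subr0 in hG.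
set G' := \sum_k _ in hG.
have hG' : loc_ideal a b F G G'.
  rewrite -[G'](subKr G); apply: loc_idealB; first exact: loc_ideal_r.
  exact: divides_loc.
have hGG' : loc_ideal a b F G' G.
  rewrite -[G](subrK G'); apply: loc_idealD; last exact: loc_ideal_r.
  exact: divides_loc.
pose m k := monom C (e k).1 (e k).2.
set D := reduced_wronskian L F e.
have eW : \det (wronskian_mx E m) = (\prod_k m k) * D by exact: wronskian_monom.
case: (classic (divides F D)) => hD; last first.
  have [k0 ck0] : exists k, c k != 0.
    apply: NNPP => hn; apply: hGF; have e0 : G' = 0.
      rewrite /G' big1 // => k _; have [->|ck] := eqVneq (c k) 0.
        by rewrite !polyC0 mul0r.
      by case: hn; exists k.
    by rewrite e0 subr0 in hG.
  have hD' : loc_ideal a b F G D.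
    apply: (@loc_ideal_unit _ _ _ _ _ (\prod_k m k)).
      by apply: eval2_prod => k; apply: eval2_monom.
    rewrite -eW; apply: loc_ideal_sub (loc_ideal_l _ _ _ _) hG' _.
    apply: (@wronskian_loc _ _ _ _ _ _ _ _ c k0) => //.
    have [k [l [h1 h2]]] := isolated_sub (loc_ideal_l _ _ _ _) hGG' hI.
    exact: jac_socle hL h1 h2.
  apply: spanned_sub (loc_ideal_l _ _ _ _) hD' _.
  apply: spanned_of_indep_bound => n h hh.
  have hb : bideg_le ('C(t.+1, 2) * (degX F).+1) ('C(t.+1, 2) * (degY F).+1) D.
    apply: bideg_reduced_wronskian; last exact: bideg_exact.
    by case: hL => ->; [exact: bideg_le_lineX|exact: bideg_le_lineY].
  apply: leq_trans (bezout_indep F0 hF hD hb hh) _.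
  by move: 'C(t.+1, 2) (degX F) (degY F) => x y z; nia.
have : divides F (\det (wronskian_mx E m)) by rewrite eW; apply: dividesMl.
case/(wronskian_dependent (jacL_derivation L F) EF hF hc) => g [[k1 gk1] hg].
(* The relation [g] modulo [F] eliminates monomial [k1]; the binomial grows with [t], so the bound
   for fewer monomials suffices. *)
apply: (@spannedW _ _ _ _ _ ('C(t, 2) * (2 * degX F * degY F + degX F + degY F))).
  by rewrite leq_mul2r (leq_bin2l _ (leqnSn t)) orbT.
apply: (IH (fun k => e (lift k1 k))
  (fun k => c (lift k1 k) - c k1 / g k1 * g (lift k1 k))).
have := dividesD hG (dividesMl (c k1 / g k1)%:P%:P hg); congr divides.
set q := c k1 / g k1.
have -> : \sum_i (c (lift k1 i) - q * g (lift k1 i))%:P%:P *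
    monom C (e (lift k1 i)).1 (e (lift k1 i)).2 =
   \sum_i (c (lift k1 i))%:P%:P * m (lift k1 i) -
   q%:P%:P * \sum_i (g (lift k1 i))%:P%:P * m (lift k1 i).
  rewrite mulr_sumr -sumrB; apply: eq_bigr => i _.
  by rewrite -/(m _) mulrA -[RHS]mulrBl -!polyCM -!polyCB.
rewrite /G' !(bigD1_ord k1) //= -/(m k1).
have -> : (c k1)%:P%:P = q%:P%:P * (g k1)%:P%:P by rewrite -!polyCM divfK.
move: (\sum_i _) (\sum_i _) q%:P%:P (g k1)%:P%:P (m k1) => S T Q g1 m1.
by ring.
Qed.

(** * Proof of the bound *)

Lemma jacL_const (C : fieldType) (L F : bpoly C) c : L * jac F c%:P%:P = 0.
Proof.
by rewrite /jac eulerXC eulerYC /euler derivC !(mulr0, polyC0, subrr).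
Qed.

(** The derivative of [x] is [- (x - a) y F_y x]. [F] divides neither factor in [x] alone nor [F_y],
    for degree reasons in [y], and not [y], since [b] is nonzero. *)
Lemma const_lemma_irreducible (C : numClosedFieldType) (a b : C) (F : bpoly C) :
  a != 0 -> b != 0 -> eval2 F a b = 0 -> (0 < degY F)%N -> prime_elt F ->
  const_lemma (fun P => lineX a * jac F P) F.
Proof.
move=> a0 b0 Fp dF hF; have [_ hp] := hF.
have F0 : F != 0 by apply: contraTneq dF => ->; rewrite /degY size_poly0.
apply: const_lemma_gen => //.
- exact: jacL_derivation.
- by move=> c; apply: jacL_const.
- by rewrite jacFF mulr0; apply: divides0.
have hsmall P : P != 0 -> (degY P < degY F)%N -> ~ divides F P.
  move=> P0 hP [Q eQ].
  have Q0 : Q != 0 by apply: contraNneq P0 => h; rewrite eQ h mul0r.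
  by move: hP; rewrite eQ degYM // ltnNge leq_addl.
have hconst (f : {poly C}) : f != 0 -> ~ divides F f%:P.
  by move=> f0; apply: hsmall; rewrite ?polyC_eq0 ?degY_polyC.
have -> : lineX a * jac F 'X%:P = - (lineX a * ('X * (F^`() * 'X%:P))).
  by rewrite /jac eulerXC eulerYC /eulerY /euler derivX; ring.
move/dividesN; rewrite opprK => /hp [|/hp [|/hp [|]]].
- by apply: hconst; rewrite polyXsubC_eq0.
- case=> Q eQ; have := congr1 (fun P : bpoly C => eval2 P a b) eQ.
  rewrite /= eval2M Fp mulr0 /eval2 hornerX hornerC => /eqP.
  by rewrite (negPf b0).
- have szF : size F = (degY F).+1 by rewrite /degY prednK // size_poly_gt0.
  have dF0 : F^`() != 0.
    apply/eqP => h; have := congr1 (fun P : bpoly C => P`_(degY F).-1) h.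
    rewrite coef_deriv coef0 prednK // => /polyP /(_ (size F`_(degY F)).-1) /eqP.
    rewrite coef0 coefMn mulrn_eq0 (gtn_eqF dF) /= -[_`_ _]/(lead_coef (lead_coef F)).
    by rewrite !lead_coef_eq0 (negPf F0).
  apply: hsmall => //; have := lt_size_deriv F0.
  by rewrite szF /degY; case: (size F^`()).
- by apply: hconst; rewrite polyX_eq0.
Qed.

(** On the line [x = a] the derivation is [a (y - b) y d/dy], so the claim is the one-variable
    [proportional_of_wronskian0]. *)
Lemma const_lemma_lineX (C : numClosedFieldType) (a b : C) :
  a != 0 -> const_lemma (fun P => lineY b * jac (lineX a) P) (lineX a).
Proof.
move=> a0 A B hB /divides_lineXP h.
have ev_euler P : evalX a (eulerY P) = euler (evalX a P).
  rewrite /evalX /eulerY /euler rmorphM /= swapXY_X hornerM hornerC.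
  by rewrite !horner_swapXY deriv_map.
have evE P : evalX a (lineY b * jac (lineX a) P) = ('X - b%:P) * (a%:P * euler (evalX a P)).
  rewrite /jac eulerXC eulerYC mul0r subr0 evalXM (evalXM _ _%:P) ev_euler evalXC.
  congr (_ * (_ * _)); last by rewrite /euler derivB derivX derivC subr0 mulr1 hornerX.
  by rewrite /lineY evalXB evalXC hornerC /evalX swapXY_X hornerC.
move: h; rewrite evalXB (evalXM _ B) (evalXM _ A) !evE => h.
have hB' : evalX a B != 0 by apply/eqP => /divides_lineXP.
have h' : evalX a B * euler (evalX a A) = evalX a A * euler (evalX a B).
  apply: (mulfI (_ : ('X - b%:P) * a%:P != 0)).
    by rewrite mulf_neq0 ?polyXsubC_eq0 // polyC_eq0.
  by apply/eqP; rewrite -subr_eq0 -h; apply/eqP; ring.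
have [c ec] := proportional_of_wronskian0 hB' h'.
exists c; apply/divides_lineXP.
by rewrite evalXB evalXM evalXC hornerC ec mul_polyC subrr.
Qed.

Lemma spanned_monomials (C : numClosedFieldType) (a b : C) (F G : bpoly C) t
    (e : 'I_t -> nat * nat) (c : 'I_t -> C) :
  a != 0 -> b != 0 -> F != 0 -> isolated a b F G ->
  G = \sum_k (c k)%:P%:P * monom C (e k).1 (e k).2 ->
  spanned a b F G ('C(t, 2) * (2 * degX F * degY F + degX F + degY F)).
Proof.
move=> a0 b0; move: {2}(degX F + degY F)%N (leqnn (degX F + degY F)) => s.
elim: s F => [|s IH] F hs F0 hI eG.
all: have [Fp|Fp] := eqVneq (eval2 F a b) 0; last first.
1,3: apply: (@spannedW _ _ _ _ _ 0) => //; apply: spanned_unit;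
  by apply: (loc_ideal_unit Fp); rewrite mulr1; apply: loc_ideal_l.
  move: hs; rewrite leqn0 addn_eq0 => /andP[/eqP h1 /eqP h2].
  move: (F`_0`_0) (deg0_const h1 h2) => k eF; move: F0 Fp.
  by rewrite eF eval2C hornerC => /eqP F0 k0; case: F0; rewrite k0 !polyC0.
case: (classic (irreducible_bpoly F)) => hirr; last first.
  have [A [B [eF hA hB]]] : exists A B,
      [/\ F = A * B, (0 < degX A + degY A)%N & (0 < degX B + degY B)%N].
    apply: NNPP => hn; apply: hirr => A B eF.
    case: (posnP (degX A + degY A)) => hA; [by left|right].
    by case: (posnP (degX B + degY B)) => // hB; case: hn; exists A, B.
  have A0 : A != 0 by apply: contraNneq F0 => h; rewrite eF h mul0r.
  have B0 : B != 0 by apply: contraNneq F0 => h; rewrite eF h mulr0.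
  have eX : degX F = (degX A + degX B)%N by rewrite eF degXM.
  have eY : degY F = (degY A + degY B)%N by rewrite eF degYM.
  rewrite eX eY in hs *; rewrite eF in hI *.
  have sA : spanned a b A G ('C(t, 2) * (2 * degX A * degY A + degX A + degY A)).
    apply: IH => //; first by lia.
    apply: isolated_sub hI; last exact: loc_ideal_r.
    by rewrite mulrC; apply/loc_idealMl/loc_ideal_l.
  have sB : spanned a b B G ('C(t, 2) * (2 * degX B * degY B + degX B + degY B)).
    apply: IH => //; first by lia.
    apply: isolated_sub hI; last exact: loc_ideal_r.
    exact/loc_idealMl/loc_ideal_l.
  apply: spannedW (spannedM hI sA sB).
  (* Superadditivity: the product of the summed degrees only adds nonnegative cross terms. *)
  by rewrite -mulnDr leq_mul2l; apply/orP; right; nia.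
have hdiv : divides F (G - \sum_k (c k)%:P%:P * monom C (e k).1 (e k).2).
  by rewrite -eG subrr; apply: divides0.
have [dY|dY] := posnP (degY F); last first.
  have hF := irreducible_prime dY hirr.
  apply: (spanned_prime a0 b0 F0 Fp hF _ _ hI hdiv); first by left; reflexivity.
  exact: const_lemma_irreducible b0 Fp dY hF.
(* An irreducible [F] free of [y] and vanishing at the point is a scalar multiple of [x - a]. *)
have eF : F = (F`_0)%:P.
  by apply: size1_polyC; move: dY; rewrite /degY; case: (size F) => [|[]].
have /factor_theorem [f ef] : root F`_0 a.
  by rewrite rootE; move: Fp; rewrite eF eval2C coefC /= => ->.
have eF' : F = f%:P * lineX a by rewrite eF ef polyCM.
have f0 : f%:P != 0 :> bpoly C by apply: contraNneq F0 => h; rewrite eF' h mul0r.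
have df : degX (f%:P : bpoly C) = 0%N.
  case: (hirr _ _ eF'); last by rewrite degX_lineX.
  by move/eqP; rewrite addn_eq0 => /andP[/eqP].
have ef' := deg0_const df (degY_polyC f).
move: (f%:P`_0`_0) ef' => k ef'.
have k0 : k != 0 by apply: contraNneq f0 => h; rewrite ef' h !polyC0.
have hFl : loc_ideal a b F G (lineX a).
  apply: (@loc_ideal_unit _ _ _ _ _ k%:P%:P); first by rewrite eval2C hornerC.
  by rewrite -ef' -eF'; apply: loc_ideal_l.
apply: (spanned_sub hFl (loc_ideal_r _ _ _ _)).
have -> : degX F = degX (lineX a) by rewrite eF' degXM ?lineX_neq0 // df.
have -> : degY F = degY (lineX a) by rewrite dY degY_polyC.
have hI' : isolated a b (lineX a) G.
  apply: isolated_sub hI; last exact: loc_ideal_r.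
  by rewrite eF'; apply/loc_idealMl/loc_ideal_l.
have hd : divides (lineX a) (G - \sum_k (c k)%:P%:P * monom C (e k).1 (e k).2).
  by rewrite -eG subrr; apply: divides0.
apply: (spanned_prime a0 b0 (lineX_neq0 a) (eval2_lineX a b) (prime_lineX a) _ _ hI' hd).
  by right; reflexivity.
exact: const_lemma_lineX.
Qed.

(** * Passage from fractions to polynomials *)

Lemma tofracbD (C : fieldType) (P Q : bpoly C) :
  tofracb (P + Q) = tofracb P + tofracb Q.
Proof. exact: rmorphD. Qed.

Lemma tofracbM (C : fieldType) (P Q : bpoly C) :
  tofracb (P * Q) = tofracb P * tofracb Q.
Proof. exact: rmorphM. Qed.

Lemma tofracb1 (C : fieldType) : tofracb (1 : bpoly C) = 1.
Proof. exact: rmorph1. Qed.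

Lemma tofracb_neq0 (C : fieldType) (a b : C) (P : bpoly C) :
  eval2 P a b != 0 -> tofracb P != 0.
Proof.
move=> h; rewrite /tofracb tofrac_eq0; apply: contraNneq h => ->.
by rewrite /eval2 !horner0.
Qed.

Lemma tofracb_sum (C : fieldType) (I : finType) (P : I -> bpoly C) :
  tofracb (\sum_i P i) = \sum_i tofracb (P i).
Proof. exact: rmorph_sum. Qed.

Lemma tofracb_inj (C : fieldType) (P Q : bpoly C) :
  tofracb P = tofracb Q -> P = Q.
Proof. by move/eqP; rewrite /tofracb tofrac_eq => /eqP. Qed.

Lemma clear_denominators (K : fieldType) (A B U V F G : K) :
  U != 0 -> V != 0 ->
  U * V * (A / U * F + B / V * G) = A * V * F + B * U * G.
Proof. by move=> U0 V0; field; rewrite U0 V0. Qed.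

Lemma clear_denominator (K : fieldType) (A B U F G : K) :
  U != 0 -> U * (A / U * F + B / U * G) = A * F + B * G.
Proof. by move=> U0; field. Qed.

Lemma cancel_denominator (K : fieldType) (g A B U V F G : K) :
  g != 0 -> U != 0 -> V != 0 ->
  g * (A / (g * U) * F + B / (g * V) * G) = A / U * F + B / V * G.
Proof. by move=> g0 U0 V0; field; rewrite g0 U0 V0. Qed.

Lemma local_ideal_tofrac (C : fieldType) (a b : C) (F G P : bpoly C) :
  in_local_ideal F G a b (tofracb P) <-> loc_ideal a b F G P.
Proof.
split=> [[al [be [[A [U [U0 ->]]] [[B [V [V0 ->]]] e]]]]|[U [A [B [U0 e]]]]].
  exists (U * V), (A * V), (B * U); rewrite eval2M mulf_neq0 //; split=> //.
  apply: tofracb_inj; rewrite tofracbD !tofracbM e.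
  exact: clear_denominators (tofracb_neq0 U0) (tofracb_neq0 V0).
exists (tofracb A / tofracb U), (tofracb B / tofracb U).
split; first by exists A, U.
split; first by exists B, U.
have u0 := tofracb_neq0 U0.
apply: (mulfI u0); rewrite -tofracbM e tofracbD !tofracbM.
by rewrite clear_denominator.
Qed.

(** A common denominator of finitely many elements is a unit at the point, so multiplying by it
    preserves independence modulo the ideal. *)
Lemma local_dim_indep (C : fieldType) (a b : C) (F G : bpoly C) n :
  local_dim_ge F G a b n <->
  exists h : 'I_n -> bpoly C, indep_mod a b F G h.
Proof.
split=> [[q [hq hi]]|[h hi]]; last first.
  exists (fun i => tofracb (h i)); split.
    by move=> i; exists (h i), 1; rewrite eval2_1 oner_neq0 tofracb1 divr1.
  move=> c; under eq_bigr do rewrite -tofracbM.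
  by rewrite -tofracb_sum local_ideal_tofrac; apply: hi.
have /fin_all_exists2 [f hf] i : exists2 fg : bpoly C * bpoly C,
    eval2 fg.2 a b != 0 & q i = tofracb fg.1 / tofracb fg.2.
  by case: (hq i) => f [g [g0 e]]; exists (f, g).
move=> ef; pose g := \prod_i (f i).2.
have g0 : eval2 g a b != 0 by apply: eval2_prod.
have tg0 := tofracb_neq0 g0.
exists (fun i => (f i).1 * \prod_(j | j != i) (f j).2) => c hc; apply: hi.
have eh i : tofracb ((f i).1 * \prod_(j | j != i) (f j).2) = tofracb g * q i.
  have eg : g = (f i).2 * \prod_(j | j != i) (f j).2 by rewrite /g (bigD1 i).
  rewrite ef eg !tofracbM; have f0 := tofracb_neq0 (hf i).
  by rewrite [RHS]mulrC mulrA divfK.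
move/local_ideal_tofrac: hc.
have -> : tofracb (\sum_i (c i)%:P%:P * ((f i).1 * \prod_(j | j != i) (f j).2)) =
    tofracb g * \sum_i tofracb (c i)%:P%:P * q i.
  by rewrite tofracb_sum mulr_sumr; apply: eq_bigr => i _; rewrite tofracbM eh mulrCA.
move=> [al [be [[A [U [U0 ->]]] [[B [V [V0 ->]]] e]]]].
exists (tofracb A / tofracb (g * U)), (tofracb B / tofracb (g * V)).
split; first by exists A, (g * U); rewrite eval2M mulf_neq0.
split; first by exists B, (g * V); rewrite eval2M mulf_neq0.
apply: (mulfI tg0); rewrite e !tofracbM.
exact/esym/(cancel_denominator _ _ _ _ tg0 (tofracb_neq0 U0) (tofracb_neq0 V0)).
Qed.

(** Finite dimension gives a nonzero [p] with [p(Z)] in the ideal. Writing [p = X^m q] with [q(0)]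
    nonzero makes [q(Z)] a unit at the point, leaving [Z^m]. *)
Lemma power_of_finite (C : fieldType) (a b : C) (F G Z : bpoly C) :
  imult_finite F G a b -> eval2 Z a b = 0 ->
  exists k, loc_ideal a b F G (Z ^+ k).
Proof.
move=> [N hN] Z0.
have : ~ indep_mod a b F G (fun i : 'I_N.+1 => Z ^+ i).
  move=> hi; have := hN N.+1; rewrite ltnn => h; suff : false by [].
  by apply: h; apply/local_dim_indep; exists (fun i => Z ^+ i).
move=> hn; have [c [hc [i0 ci0]]] : exists c : 'I_N.+1 -> C,
    loc_ideal a b F G (\sum_i (c i)%:P%:P * Z ^+ i) /\ exists i, c i != 0.
  apply: NNPP => hn'; apply: hn => c hc i; apply/eqP/negPn/negP => ci.
  by apply: hn'; exists c; split=> //; exists i.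
pose p := \poly_(i < N.+1) c (inord i).
have p0 : p != 0.
  apply: contraNneq ci0 => h; have := congr1 (fun r : {poly C} => r`_i0) h.
  by rewrite coef_poly ltn_ord coef0 inord_val => ->.
pose ph := fun r : {poly C} => (map_poly (fun x : C => x%:P%:P : bpoly C) r).[Z].
have phE : \sum_i (c i)%:P%:P * Z ^+ i = ph p.
  rewrite /ph (@horner_coef_wide _ N.+1); last first.
    by apply: leq_trans (size_poly _ _) (size_poly _ _).
  apply: eq_bigr => i _; congr (_ * _).
  by rewrite (coef_map (polyC \o polyC)) /= coef_poly ltn_ord inord_val.
have [m [q hq eq]] := multiplicity_XsubC p 0.
rewrite p0 /= subr0 in hq eq.
exists m; apply: (@loc_ideal_unit _ _ _ _ _ (ph q)).
  have -> : eval2 (ph q) a b = q.[0].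
    rewrite /ph -[in RHS]Z0; elim/poly_ind: q {hq eq} => [|r x IH].
      by rewrite map_poly0 !horner0 /eval2 !horner0.
    rewrite (rmorphD (map_poly (polyC \o polyC))) (rmorphM (map_poly (polyC \o polyC))) /=.
    rewrite map_polyX map_polyC /= !hornerE eval2D eval2M eval2C hornerC.
    by rewrite -IH.
  exact: hq.
have -> : ph q * Z ^+ m = ph p.
  rewrite /ph eq (rmorphM (map_poly (polyC \o polyC))) (rmorphXn (map_poly (polyC \o polyC))) /=.
  by rewrite map_polyX hornerM hornerXn.
by rewrite -phE.
Qed.

Lemma tdeg_deg (C : fieldType) (F : bpoly C) :
  (degX F <= tdeg F)%N /\ (degY F <= tdeg F)%N.
Proof.
have key j : F`_j != 0 -> ((size (F`_j)%R).-1 + j <= tdeg F)%N.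
  move=> h; have hj : (j < size F)%N.
    by rewrite ltnNge; apply: contra h => h; rewrite nth_default.
  exact: (@leq_bigmax_cond _ (fun k : 'I_(size F) => F`_k != 0)
    (fun k => ((size (F`_k)%R).-1 + k)%N) (Ordinal hj) h).
split; last first.
  have [->|F0] := eqVneq F 0; first by rewrite /degY size_poly0.
  have := key (degY F); rewrite -[F`_ _]/(lead_coef F) lead_coef_eq0 F0.
  by move=> /(_ isT); apply: leq_trans; apply: leq_addl.
suff : (sizeY F <= (tdeg F).+1)%N by rewrite /degX; case: (sizeY F).
apply/bigmax_leqP => j _; have [->|h] := eqVneq F`_j 0; first by rewrite size_poly0.
by have := key j h; case: (size F`_j) => // n /=; lia.
Qed.

Lemma nmonomials_sum (C : fieldType) (G : bpoly C) :
  exists (e : 'I_(nmonomials G) -> nat * nat) (c : 'I_(nmonomials G) -> C),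
    G = \sum_k (c k)%:P%:P * monom C (e k).1 (e k).2.
Proof.
pose row j := [seq (i, j) | i <- iota 0 (size G`_j) & G`_j`_i != 0].
pose s := flatten [seq row j | j <- iota 0 (size G)].
have ei n : iota 0 n = index_iota 0 n by rewrite /index_iota subn0.
have sz : size s = nmonomials G.
  rewrite /s size_flatten /shape -map_comp sumnE big_map /nmonomials.
  rewrite ei big_mkord; apply: eq_bigr => j _.
  rewrite /row /= size_map size_filter.
  rewrite -[X in _ = count _ X](mkseq_nth 0) count_map.
  by apply: eq_count.
have eG : G = \sum_(x <- s) (G`_x.2`_x.1)%:P%:P * monom C x.1 x.2.
  rewrite /s big_flatten big_map.
  rewrite ei big_mkord.
  rewrite -[LHS]coefK poly_def; apply: eq_bigr => j _.
  rewrite /row big_map big_filter /=.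
  rewrite -[X in X *: _ = _]coefK poly_def -mul_polyC rmorph_sum mulr_suml /=.
  rewrite ei big_mkord [RHS]big_mkcond /=.
  apply: eq_bigr => i _; case: eqP => [->|_] /=.
    by rewrite scale0r polyC0 mul0r.
  by rewrite /monom -mul_polyC polyCM mulrA.
rewrite -sz; exists (fun k => nth (0, 0)%N s k).
exists (fun k => let x := nth (0, 0)%N s k in G`_x.2`_x.1).
by rewrite {1}eG (big_nth (0, 0)%N) big_mkord.
Qed.

Theorem mainTheorem1 (C : numClosedFieldType) (F G : {poly {poly C}}) (d t : nat)
  (a b : C) :
  tdeg F = d -> (1 <= d)%N ->
  nmonomials G = t -> (1 <= t)%N ->
  a != 0 -> b != 0 ->
  eval2 F a b = 0 -> eval2 G a b = 0 ->
  imult_finite F G a b ->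
  imult_le F G a b (5 * d ^ 2 * t ^ 2) 2.
Proof.
move=> <- d1 <- t1 a0 b0 Fp Gp hfin n /local_dim_indep [h hi].
have F0 : F != 0.
  by apply: contraTneq d1 => ->; rewrite /tdeg size_poly0 big_ord0.
have hI : isolated a b F G.
  have [k hk] := power_of_finite hfin (eval2_lineX a b).
  by have [m hm] := power_of_finite hfin (eval2_lineY a b); exists k, m.
have [e [c eG]] := nmonomials_sum G.
have := spanned_indep (spanned_monomials a0 b0 F0 hI eG) hi.
have [hX hY] := tdeg_deg F.
(* This supplies [t (t - 1) = 2 'C(t, 2)]. *)
have := mul_bin_diag (nmonomials G) 1.
rewrite bin1; move: (nmonomials G) t1 'C(_, 2) => m m1 T hT hn.
move: (tdeg F) (degX F) (degY F) d1 hX hY hn => D x y D1 hx hy hn.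
have {}hn : (n <= T * (2 * D * D + D + D))%N.
  by apply: leq_trans hn _; rewrite leq_mul2l; apply/orP; right; nia.
case: m m1 hT => // m _ /= hT; case: D D1 {hx hy} hn => // D _ hn.
nia.
Qed.
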